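(* Probability distributions of measurement results on $O(\log N)$ qubits in the HC$m$Q model on $N$ qubits can be classically sampled in polynomial time within a $1/poly(N)$ L1-norm error. That is, for every constant $c>0$ and every polynomial $r$ there is a classical probabilistic polynomial-time algorithm which, given $m$ with $0\le m\le N$, the description of an HC$m$Q circuit on $N$ qubits (with $poly(N)$ gates) and a set $K$ of $k\le c\log N$ of its qubits, outputs $z\in\{0,1\}^k$ with probability $q_z$ such that $$\sum_{z\in\{0,1\}^k}|p_z-q_z|\le\frac{1}{r(N)},$$ where $p_z$ is the probability that the final computational-basis measurement of the qubits in $K$ in the HC$m$Q circuit yields $z$.
   Context: $H$ is the one-qubit Hadamard gate and $I$ the one-qubit identity. An HC$m$Q (Hadamard-classical circuit with $m$-qubit) circuit on $N$ qubits is the following: start from $|0^N\rangle$; apply $H^{\otimes(N-m)}\otimes I^{\otimes m}$ (Hadamard on every qubit except the last $m$); apply coherently a polynomial-time uniformly-generated classical reversible circuit $C:\{0,1\}^N\to\{0,1\}^N$ (built from polynomially many classical reversible gates such as $X$, CNOT, Toffoli acting on the $N$ wires, viewed as the permutation unitary $|w\rangle\mapsto|C(w)\rangle$); apply $H^{\otimes(N-m)}\otimes I^{\otimes m}$ again; finally measure all qubits in the computational basis. *)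

(* Defs.v *)
From HB Require Import structures.
From mathcomp Require Import all_boot all_order all_algebra.
From mathcomp Require Import reals exp complex.

Set Implicit Arguments.
Unset Strict Implicit.
Unset Printing Implicit Defensive.

Import Order.TTheory GRing.Theory Num.Theory.
Local Open Scope ring_scope.

Definition bits (N : nat) : Type := {ffun 'I_N -> bool}.

(** * Classical reversible circuits *)

(* Multiply-controlled NOT: [target] is flipped when every wire of [controls]
   carries 1.  Zero, one and two controls give X, CNOT and Toffoli; every
   reversible gate on a bounded number of wires is a bounded product of these
   gates on the same wires, without ancillas. *)
Record gate (N : nat) := Gate {
  target : 'I_N;
  controls : {set 'I_N};
  target_free : target \notin controls }.

Definition gate_act N (g : gate N) (w : bits N) : bits N :=
  [ffun i => w i (+) ((i == target g) && [forall j in controls g, w j])].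

Lemma gate_actK N (g : gate N) : involutive (gate_act g).
Proof.
move=> w; apply/ffunP => i; rewrite !ffunE.
have -> : [forall j in controls g, gate_act g w j]
          = [forall j in controls g, w j].
  apply: eq_forallb => j; case jg: (j \in controls g) => //=; rewrite ffunE.
  have /negbTE -> : j != target g; last by rewrite addbF.
  by apply: contraTneq jg => ->; exact: target_free.
by rewrite -addbA addbb addbF.
Qed.

Definition circuit (N : nat) : Type := seq (gate N).

(* The head of the list is the gate applied first. *)
Definition circuit_act N (C : circuit N) (w : bits N) : bits N :=
  foldl (fun v g => gate_act g v) w C.

(** * Quantum circuits of the Hadamard-classical model *)

Section Quantum.

Variables (R : realType) (N : nat).

Definition state : Type := {ffun bits N -> R[i]}.

(* [U w w'] is the matrix entry <w|U|w'>. *)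
Definition operator : Type := bits N -> bits N -> R[i].

Definition op_apply (U : operator) (psi : state) : state :=
  [ffun w => \sum_(w' : bits N) U w w' * psi w'].

Definition basis_state (w0 : bits N) : state := [ffun w => (w == w0)%:R].

Definition hadamard (a b : bool) : R[i] :=
  (-1) ^+ (a && b) * (real_complex R (Num.sqrt 2)^-1).

Definition identity1 (a b : bool) : R[i] := (a == b)%:R.

Definition tensor (U : 'I_N -> bool -> bool -> R[i]) : operator :=
  fun w w' => \prod_(i < N) U i (w i) (w' i).

Definition perm_op (f : bits N -> bits N) : operator :=
  fun w w' => (w == f w')%:R.

Definition hadamard_layer (m : nat) : operator :=
  tensor (fun i => if (i < N - m)%N then hadamard else identity1).

Definition hcmq_state (m : nat) (C : circuit N) : state :=
  op_apply (hadamard_layer m)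
    (op_apply (perm_op (circuit_act C))
      (op_apply (hadamard_layer m)
        (basis_state [ffun=> false]))).

(* The restriction of [w] to [K], in increasing order of the qubits. *)
Definition outcome (K : {set 'I_N}) (w : bits N) : seq bool :=
  [seq w i | i <- enum K].

Definition hcmq_prob (m : nat) (C : circuit N) (K : {set 'I_N})
    (z : #|K|.-tuple bool) : R :=
  \sum_(w : bits N | outcome K w == z)
     Normc.normc (hcmq_state m C w) ^+ 2.

End Quantum.

(** * Probabilistic algorithms *)

(* Structured programs for a probabilistic machine with finitely many stacks of
   bits (those named in the program).  A k-tape Turing machine is such a machine
   with 2k stacks, and conversely, with constant overhead: every step pushes or
   inspects a single bit, or tosses a single coin.
   [Pop s pe p0 p1] removes the top bit of stack [s] and continues with [p0] or
   [p1] according to its value, or with [pe] if [s] is empty.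
   [While s p] repeats [p] as long as stack [s] is nonempty. *)
Inductive prog : Type :=
| Skip
| Push of nat & bool
| Toss of nat
| Pop of nat & prog & prog & prog
| Seq of prog & prog
| While of nat & prog.

Definition store : Type := nat -> seq bool.

Definition upd (st : store) (s : nat) (l : seq bool) : store :=
  fun s' => if s' == s then l else st s'.

(* [coins] is the unread part of the random tape.  A run of [t] steps reads at
   most [t] coins, so a tape of length [t] cannot be exhausted. *)
Record config := Config {
  todo : seq prog;
  mem : store;
  coins : seq bool }.

Definition step (c : config) : config :=
  let: Config ps st rs := c in
  match ps with
  | [::] => c
  | Skip :: k => Config k st rs
  | Push s b :: k => Config k (upd st s (b :: st s)) rs
  | Toss s :: k => Config k (upd st s (head false rs :: st s)) (behead rs)
  | Pop s pe p0 p1 :: k =>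
      match st s with
      | [::] => Config (pe :: k) st rs
      | b :: l => Config ((if b then p1 else p0) :: k) (upd st s l) rs
      end
  | Seq p q :: k => Config (p :: q :: k) st rs
  | While s p :: k =>
      if st s is [::] then Config k st rs else Config (p :: ps) st rs
  end.

(* The input is initially on stack 0, all other stacks being empty. *)
Definition init (P : prog) (x rs : seq bool) : config :=
  Config [:: P] (upd (fun=> [::]) 0 x) rs.

Definition run (P : prog) (x rs : seq bool) (t : nat) : config :=
  iter t step (init P x rs).

Definition halted (c : config) : bool := nilp (todo c).

Definition output (c : config) : seq bool := mem c 1.

(* Probability that [P], run for [t] steps on input [x], outputs [z]. *)
Definition out_prob (R : realType) (P : prog) (x : seq bool) (t : nat)
    (z : seq bool) : R :=
  #|[set rs : t.-tuple bool | output (run P x rs t) == z]|%:R / 2 ^+ t.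

(** * Description of an instance *)

Definition mask_of N (A : {set 'I_N}) : seq bool :=
  [seq i \in A | i <- enum 'I_N].

Definition encode_gate N (g : gate N) : seq bool :=
  mask_of [set target g] ++ mask_of (controls g).

(* Every row has length [N], which is given first, so no separators between
   rows are needed. *)
Definition encode N (m : nat) (C : circuit N) (K : {set 'I_N}) : seq bool :=
  nseq N true ++ false :: nseq m true ++ false ::
  mask_of K ++ flatten [seq encode_gate g | g <- C].

(* Main.v *)
Require Import Defs.
From HB Require Import structures.
From mathcomp Require Import all_boot all_order all_algebra.
From mathcomp Require Import reals exp complex.
From mathcomp Require Import zify ring lra.

(* Qubits outside [K] may be measured in the computational basis.  Let [K1] be
   the qubits of [K] that receive the final Hadamard gate.  Run the circuit on a
   uniform classical input x and let w = C(x).  The other qubits then collapse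
   the state to the uniform superposition over the set S of rows v that agree
   with w off [K1] and whose preimage under C ends in [0^m], so a string z on
   [K1] is observed with probability s_z^2 / (2^k |S|), where k = #|K1| and s_z is
   the sum of (-1)^(z.v) over S.  There are only 2^k <= poly(N) candidates v, and
   membership in S is tested by running C backwards, so the integer |s_z| is
   computable exactly.  A trial tosses z uniformly and accepts it with
   probability (s_z / 2^k)^2; it succeeds with probability |S| / 4^k >= 4^-k, and
   an accepted z has the right law.  After b 4^k trials the failure probability
   is at most 1 / (1 + b).

   Event probabilities D / 2^k are produced by k rounds of randomized halving
   D |-> floor ((D + coin) / 2), whose expectation is D / 2^k and whose final
   value is 0 or 1. *)

Set Implicit Arguments.
Unset Strict Implicit.
Unset Printing Implicit Defensive.

Import Order.TTheory GRing.Theory Num.Theory.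

(** * Big-step execution of programs *)

Local Open Scope nat_scope.

(** Rejection is needed because coins only give dyadic probabilities, whereas the law of z given w
    has denominator 2^k |S| and |S| need not be a power of 2. The only error is that of a run in
    which every trial fails and z = 0 is output: two distributions are at L1 distance at most 2, so
    the total error is at most 2 / (1 + b), and b is taken at least 2 r(N). The success rate |S| /
    4^k is Parseval's identity for the indicator of S, and |S| >= 1 because w itself lies in S. The
    failure bound is Bernoulli's inequality (1 - a)^L (1 + L a) <= 1 with a >= 4^-k and L = b 4^k.
    Dropping the final Hadamard gates off K is harmless since H is orthogonal: summing over an
    unobserved outcome bit leaves a Kronecker delta. Every trial reads exactly 3k coins, accepted or
    not: k for z and k for each factor of the squared acceptance probability. The tape thus splits
    into independent blocks. A trial restores its stacks without saving the row or the circuit: the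
    circuit is run forth and back, and the enumeration of candidates is a cyclic counter. *)

Definition exec (p : prog) (st : store) (rs : seq bool) (st' : store)
    (rs' : seq bool) (n : nat) : Prop :=
  forall k, exists2 n', n' <= n &
    iter n' step (Config (p :: k) st rs) = Config k st' rs'.

(** Step counts are upper bounds and stores are functions compared by extensionality, so a symbolic
    execution ends with one store equation and one inequality. *)
Lemma exec_weaken p st rs st1 rs1 n1 st2 rs2 n2 :
  exec p st rs st1 rs1 n1 -> st1 = st2 -> rs1 = rs2 -> n1 <= n2 ->
  exec p st rs st2 rs2 n2.
Proof.
by move=> ep <- <- le k; have [n' le' e] := ep k; exists n' => //; lia.
Qed.

(** Composition works because [exec] quantifies over the continuation [k]: the first part is run
    with [q :: k] as its continuation. *)
Lemma exec_seq p q st rs st1 rs1 st2 rs2 n1 n2 :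
  exec p st rs st1 rs1 n1 -> exec q st1 rs1 st2 rs2 n2 ->
  exec (Seq p q) st rs st2 rs2 (n1 + n2).+1.
Proof.
move=> ep eq k; have [a la ea] := ep (q :: k); have [b lb eb] := eq k.
by exists (b + a).+1; [lia | rewrite iterSr iterD /= ea].
Qed.

Lemma exec_skip st rs : exec Skip st rs st rs 1.
Proof. by move=> k; exists 1. Qed.

Lemma exec_push s b st rs :
  exec (Push s b) st rs (upd st s (b :: st s)) rs 1.
Proof. by move=> k; exists 1. Qed.

Lemma exec_toss s b st rs :
  exec (Toss s) st (b :: rs) (upd st s (b :: st s)) rs 1.
Proof. by move=> k; exists 1. Qed.

Lemma exec_pop_nil s pe p0 p1 st rs st' rs' n :
  st s = [::] -> exec pe st rs st' rs' n ->
  exec (Pop s pe p0 p1) st rs st' rs' n.+1.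
Proof.
move=> e ep k; have [a la ea] := ep k.
by exists a.+1 => //; rewrite iterSr /= e.
Qed.

Lemma exec_pop s pe (body : bool -> prog) b l st rs st' rs' n :
  st s = b :: l -> exec (body b) (upd st s l) rs st' rs' n ->
  exec (Pop s pe (body false) (body true)) st rs st' rs' n.+1.
Proof.
move=> e ep k; have [a la ea] := ep k.
by exists a.+1 => //; rewrite iterSr /= e; case: (b) ea.
Qed.

Lemma exec_pop0 s pe p0 p1 l st rs st' rs' n :
  st s = false :: l -> exec p0 (upd st s l) rs st' rs' n ->
  exec (Pop s pe p0 p1) st rs st' rs' n.+1.
Proof. exact: (@exec_pop s pe (fun b => if b then p1 else p0) false). Qed.

Lemma exec_pop1 s pe p0 p1 l st rs st' rs' n :
  st s = true :: l -> exec p1 (upd st s l) rs st' rs' n ->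
  exec (Pop s pe p0 p1) st rs st' rs' n.+1.
Proof. exact: (@exec_pop s pe (fun b => if b then p1 else p0) true). Qed.

Lemma exec_while_nil s p st rs :
  st s = [::] -> exec (While s p) st rs st rs 1.
Proof. by move=> e k; exists 1; rewrite //= e. Qed.

Lemma exec_while s p st rs st1 rs1 st2 rs2 n1 n2 :
  st s <> [::] -> exec p st rs st1 rs1 n1 ->
  exec (While s p) st1 rs1 st2 rs2 n2 ->
  exec (While s p) st rs st2 rs2 (n1 + n2).+1.
Proof.
move=> ne ep eq k; have [a la ea] := ep (While s p :: k).
have [b lb eb] := eq k.
exists (b + a).+1; first by lia.
by rewrite iterSr iterD /=; case: (st s) ne => //= _ _ _; rewrite ea.
Qed.

(** [While] has just tested the stack, so the [Skip] for an empty stack is never reached. *)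
Definition foreach (s : nat) (body : bool -> prog) : prog :=
  While s (Pop s Skip (body false) (body true)).

Lemma exec_foreach_nil s body st rs :
  st s = [::] -> exec (foreach s body) st rs st rs 1.
Proof. exact: exec_while_nil. Qed.

Lemma exec_foreach_cons s body b l st rs st1 rs1 st2 rs2 n1 n2 :
  st s = b :: l ->
  exec (body b) (upd st s l) rs st1 rs1 n1 ->
  exec (foreach s body) st1 rs1 st2 rs2 n2 ->
  exec (foreach s body) st rs st2 rs2 (n1 + n2).+2.
Proof.
move=> e eb ef.
have := @exec_while s _ _ _ _ _ _ _ _ _ _ (exec_pop Skip e eb) ef.
by move/(_ _); apply; rewrite e.
Qed.

Lemma upd_id st s : upd st s (st s) = st.
Proof.
by apply: boolp.funext => i; rewrite /upd; case: eqP => // ->.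
Qed.

Definition mv (a b : nat) : prog := foreach a (Push b).

Lemma exec_mv a b st rs : a != b ->
  exec (mv a b) st rs (upd (upd st a [::]) b (catrev (st a) (st b))) rs
    (3 * size (st a) + 1).
Proof.
move=> ab; move e: (st a) => l.
elim: l st e => [|x l IH] st e /=.
  apply: (exec_weaken (exec_foreach_nil _ _ e)) => //.
  by apply: boolp.funext => i; rewrite /upd; do ![case: eqP => [->|_] //].
apply: exec_weaken.
- by apply: exec_foreach_cons e (exec_push _ _ _ _) (IH _ _);
    rewrite /upd (negbTE ab) eqxx.
- apply: boolp.funext => i; rewrite /upd.
  by rewrite eqxx [b == a]eq_sym (negbTE ab); do ![case: eqP => // _].
- by [].
- by lia.
Qed.

Definition clear (s : nat) : prog := foreach s (fun=> Skip).

Lemma exec_clear s st rs :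
  exec (clear s) st rs (upd st s [::]) rs (3 * size (st s) + 1).
Proof.
move e: (st s) => l.
elim: l st e => [|x l IH] st e /=.
  by apply: (exec_weaken (exec_foreach_nil _ _ e)) => //; rewrite -e upd_id.
apply: exec_weaken.
- by apply: exec_foreach_cons e (exec_skip _ _) (IH _ _); rewrite /upd eqxx.
- by apply: boolp.funext => i; rewrite /upd; case: eqP.
- by [].
- by lia.
Qed.

(** Twenty cases because the program uses stacks 0 to 19; the remaining generic index is untouched
    by every update. *)
Ltac st_eq :=
  let i := fresh "i" in
  apply: boolp.funext => i; rewrite /upd;
  do 20 (destruct i as [|i]; [solve [cbn; congruence]|]); cbn; congruence.

Ltac look :=
  solve [cbn; first [eassumption | reflexivity | congruence]].

(** Symbolic execution: the branch of each [Pop] is chosen by what the context says of the top of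
    the stack. *)
Ltac ex :=
  lazymatch goal with
  | |- exec (Seq _ _) _ _ _ _ _ => eapply exec_seq; [ex | ex]
  | |- exec Skip _ _ _ _ _ => apply: exec_skip
  | |- exec (Push _ _) _ _ _ _ _ => apply: exec_push
  | |- exec (Toss _) _ _ _ _ _ => apply: exec_toss
  | |- exec (Pop _ _ _ _) _ _ _ _ _ =>
      first [ eapply exec_pop0; [look | ex]
            | eapply exec_pop1; [look | ex]
            | eapply exec_pop_nil; [look | ex] ]
  | |- exec (mv _ _) _ _ _ _ _ => by apply: exec_mv
  | |- exec (clear _) _ _ _ _ _ => apply: exec_clear
  end.

(* [sA] holds the gates still to be applied and [sB] those already applied, with
   every row reversed; [sV] the current row; [sX], [sY], [sT] and the flag [sF]
   are scratch.  [sM], [sK], [sJ] mark the wires that carry a Hadamard gate, the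
   measured wires and their intersection; [sZ] is the candidate outcome and [sS]
   the last accepted one; [sO] receives the output.  The other stacks are unary
   counters. *)
Local Notation sA := 0 (only parsing).
Local Notation sO := 1 (only parsing).
Local Notation sB := 2 (only parsing).
Local Notation sV := 3 (only parsing).
Local Notation sX := 4 (only parsing).
Local Notation sY := 5 (only parsing).
Local Notation sT := 6 (only parsing).
Local Notation sF := 7 (only parsing).
Local Notation sM := 8 (only parsing).
Local Notation sK := 9 (only parsing).
Local Notation sJ := 10 (only parsing).
Local Notation sZ := 11 (only parsing).
Local Notation sQ := 12 (only parsing).
Local Notation sR := 13 (only parsing).
Local Notation sL := 14 (only parsing).
Local Notation sP := 15 (only parsing).
Local Notation sN := 16 (only parsing).
Local Notation sD := 17 (only parsing).
Local Notation sE := 18 (only parsing).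
Local Notation sS := 19 (only parsing).

Definition clean (st : store) : bool :=
  [&& nilp (st sB), nilp (st sX), nilp (st sY), nilp (st sT) & nilp (st sF)].

Lemma cleanP st : clean st ->
  [/\ st sB = [::], st sX = [::], st sY = [::], st sT = [::] & st sF = [::]].
Proof. by case/and5P => /nilP ? /nilP ? /nilP ? /nilP ? /nilP ?. Qed.

(* Target mask, then control mask. *)
Definition row_gate : Type := (seq bool * seq bool)%type.

Definition enabled (c w : seq bool) : bool :=
  all (fun p => p.1 ==> p.2) (zip c w).

Definition flip (ok : bool) (t w : seq bool) : seq bool :=
  [seq p.2 (+) (p.1 && ok) | p <- zip t w].

Definition row_act (w : seq bool) (g : row_gate) : seq bool :=
  flip (enabled g.2 w) g.1 w.

Definition stream (gs : seq row_gate) : seq bool :=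
  flatten [seq g.1 ++ g.2 | g <- gs].

Definition rev_gate (g : row_gate) : row_gate := (rev g.1, rev g.2).

(** The inverse circuit, acting on rows written backwards: every gate is an involution, so reversing
    the order of the gates suffices. *)
Definition rev_gates (gs : seq row_gate) := rev (map rev_gate gs).

Definition read_target : prog :=
  foreach sV (fun v =>
    Seq (Push sX v) (Pop sA Skip (Push sT false) (Push sT true))).

Lemma exec_read_target st rs w t a : size t = size w ->
  st sV = w -> st sA = t ++ a ->
  exec read_target st rs
    (upd (upd (upd (upd st sV [::]) sX (catrev w (st sX)))
       sT (catrev t (st sT))) sA a) rs (6 * size w + 1).
Proof.
elim: w t st => [|x w IH] [|y t] st //= sz eV eA.
  by apply: (exec_weaken (exec_foreach_nil _ _ eV)) => //; st_eq.
apply: exec_weaken.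
- apply: (exec_foreach_cons eV _ (IH t _ _ _ _)).
  + by case: y eA => eA; ex.
  + by case: sz.
  + by [].
  + by [].
- by st_eq.
- by [].
- by lia.
Qed.

(** * Simulating the classical circuit *)

Definition read_controls : prog :=
  foreach sV (fun v =>
    Seq (Push sX v)
      (Pop sA Skip (Push sB false)
        (Seq (Push sB true) (if v then Skip else Push sF true)))).

(** The flag counts violated controls in unary, so that a mark is pushed without any test. Only its
    vanishing matters later; its size is bounded because it must be cleared. *)
Lemma exec_read_controls st rs w c a f : size c = size w ->
  st sV = w -> st sA = c ++ a -> st sF = nseq f true ->
  exists2 f', f' <= f + size w /\ (f' == 0) = (f == 0) && enabled c w &
  exec read_controls st rs
    (upd (upd (upd (upd (upd st sV [::]) sX (catrev w (st sX)))
       sB (catrev c (st sB))) sA a) sF (nseq f' true)) rs (8 * size w + 1).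
Proof.
elim: w c f st => [|x w IH] [|y c] f st //= sz eV eA eF.
  exists f; first by rewrite addn0 andbT.
  by apply: (exec_weaken (exec_foreach_nil _ _ eV)) => //; st_eq.
pose f1 := if y && ~~ x then f.+1 else f.
pose st1 := upd (upd (upd (upd (upd st sV w) sX (x :: st sX)) sA (c ++ a)) sB
  (y :: st sB)) sF (nseq f1 true).
have e1 : exec (Seq (Push sX x)
      (Pop sA Skip (Push sB false)
        (Seq (Push sB true) (if x then Skip else Push sF true))))
   (upd st sV w) rs st1 rs 6.
  rewrite /st1 /f1; case: y eA {st1 f1} => eA; case: (x) => /=;
  by apply: exec_weaken; [by ex | by st_eq | by [] | by []].
have [|//|//|//|f' [lf zf] e2] := IH c f1 st1; first by case: sz.
exists f'.
  split; first by move: lf; rewrite /f1; case: ifP; lia.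
  rewrite zf /f1 /enabled /=; case: (x); case: (y) => //=.
  by rewrite andbF.
apply: exec_weaken.
- by apply: (exec_foreach_cons eV e1 e2).
- by st_eq.
- by [].
- lia.
Qed.

(** The flag is tested by popping it, so a nonempty flag gets its mark back. *)
Definition flip_target : prog :=
  foreach sX (fun x =>
    Pop sT Skip
      (Seq (Push sY false) (Push sV x))
      (Seq (Push sY true)
        (Pop sF (Push sV (~~ x)) Skip (Seq (Push sF true) (Push sV x))))).

Lemma exec_flip_target st rs w t u f : size t = size w ->
  st sX = w -> st sT = t ++ u -> st sF = nseq f true ->
  exec flip_target st rs
    (upd (upd (upd (upd st sX [::]) sV (catrev (flip (f == 0) t w) (st sV)))
       sY (catrev t (st sY))) sT u) rs (9 * size w + 1).
Proof.
elim: w t st => [|x w IH] [|y t] st //= sz eV eA eF.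
  by apply: (exec_weaken (exec_foreach_nil _ _ eV)) => //; st_eq.
apply: exec_weaken.
- apply: (exec_foreach_cons eV).
  + instantiate (1 := 7).
    instantiate (1 := rs).
    instantiate (1 := upd (upd (upd (upd st sX w) sT (t ++ u))
      sV ((x (+) (y && (f == 0))) :: st sV)) sY (y :: st sY)).
    case: y eA => eA; case: (x) => /=; case: f eF {IH} => [|f] /= eF;
    by apply: exec_weaken; [by ex | by st_eq | by [] | by []].
  + by apply: (IH t) => //; case: sz.
- rewrite -/(flip (f == 0) t w).
  move: (flip _ t w) (_ && _) => w' b'; by st_eq.
- by [].
- by lia.
Qed.

(** Each transfer between stacks reverses. The row makes four transfers and keeps its orientation;
    the target mask makes three and the control mask one, so both reach [sB] reversed. *)
Definition gate_prog : prog :=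
  Seq read_target (Seq (mv sX sV) (Seq read_controls
    (Seq flip_target (Seq (mv sY sB) (clear sF))))).

Lemma size_flip ok t w : size t = size w -> size (flip ok t w) = size w.
Proof. by move=> e; rewrite size_map size_zip e minnn. Qed.

Lemma size_row_act g w : size g.1 = size w -> size (row_act w g) = size w.
Proof. exact: size_flip. Qed.

Lemma rev_flip ok t w : size t = size w ->
  rev (flip ok t w) = flip ok (rev t) (rev w).
Proof. by move=> e; rewrite /flip -map_rev rev_zip. Qed.


Lemma exec_gate st rs g a b : 
  size g.1 = size (st sV) -> size g.2 = size (st sV) ->
  st sA = g.1 ++ g.2 ++ a -> st sB = b ->
  st sX = [::] -> st sY = [::] -> st sT = [::] -> st sF = [::] ->
  exec gate_prog st rs
    (upd (upd (upd st sA a) sV (row_act (st sV) g))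
       sB (rev g.1 ++ rev g.2 ++ b)) rs (40 * (size (st sV)).+1).
Proof.
case: g => t c /= zt zc eA eB eX eY eT eF.
set w := st sV in zt zc *.
have e1 := exec_read_target rs zt erefl eA; rewrite -/w in e1.
set st1 := upd _ _ _ in e1.
have e2 := @exec_mv sX sV st1 rs isT.
set st2 := upd _ _ _ in e2.
have [|||f [lf zf] e3] := @exec_read_controls st2 rs w c a 0 zc.
- by rewrite /st2 /st1 /upd /= eX !catrevE !cats0 revK.
- by [].
- by [].
set st3 := upd _ _ _ in e3.
have e4 := @exec_flip_target st3 rs (rev w) (rev t) [::] f.
rewrite {}zf eqxx andTb in e4.
set st4 := upd _ _ _ in e4.
have e5 := @exec_mv sY sB st4 rs isT.
set st5 := upd _ _ _ in e5.
have e6 := @exec_clear sF st5 rs.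
apply: exec_weaken.
- apply: exec_seq e1 (exec_seq e2 (exec_seq e3 (exec_seq (e4 _ _ _ _) (exec_seq e5 e6)))).
  + by rewrite !size_rev.
  + by rewrite /st3 /st2 /st1 /upd /= !catrevE cats0.
  + by rewrite /st3 /st2 /st1 /upd /= !catrevE eT cats0.
  + by [].
- apply: boolp.funext => i.
  rewrite /st5 /st4 /st3 /st2 /st1 /upd.
  case: i => [//|[//|[|[|i]]]].
  + by cbn; rewrite !catrevE ?eT ?eY ?eX eB ?cats0 ?revK ?catA.
  + by rewrite /= catrevE cats0 rev_flip ?size_rev ?zt // !revK.
  + by do 4 (destruct i as [|i]; [by cbn; rewrite ?eX ?eY ?eT ?eF|]).
- by [].
- rewrite /st5 /st4 /st3 /st2 /st1 /upd /= !catrevE eX eY !cats0 !size_rev.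
  by rewrite size_nseq; lia.
Qed.

(** Positivity of [N] makes the code of a gate nonempty, so [While sA] stops exactly when no gate is
    left. *)
Definition well_sized (N : nat) (gs : seq row_gate) : bool :=
  all (fun g => [&& 0 < N, size g.1 == N & size g.2 == N]) gs.

Definition row_acts (gs : seq row_gate) (w : seq bool) : seq bool :=
  foldl row_act w gs.

Lemma size_row_acts N gs w :
  well_sized N gs -> size w = N -> size (row_acts gs w) = N.
Proof.
elim: gs w => [|g gs IH] w //= /andP[/and3P[_ /eqP s1 _] ws] sw.
by apply: IH => //; rewrite size_row_act // s1 sw.
Qed.

Lemma stream_cat gs hs : stream (gs ++ hs) = stream gs ++ stream hs.
Proof. by rewrite /stream map_cat flatten_cat. Qed.

Lemma exec_circuit N st rs gs : well_sized N gs -> clean st ->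
  st sA = stream gs -> size (st sV) = N ->
  exec (While sA gate_prog) st rs
    (upd (upd (upd st sA [::]) sV (row_acts gs (st sV)))
       sB (stream (rev_gates gs)))
    rs (size gs * (40 * N + 41) + 1).
Proof.
move=> ws /cleanP[eB eX eY eT eF] eA zV.
(* The induction needs arbitrary contents of [sB] below the gates pushed so far. *)
suff: exec (While sA gate_prog) st rs
    (upd (upd (upd st sA [::]) sV (row_acts gs (st sV)))
       sB (stream (rev_gates gs) ++ st sB))
    rs (size gs * (40 * N + 41) + 1) by rewrite eB cats0.
elim: gs st ws eX eY eT eF eA zV {eB} => [|g gs IH] st /=.
  rewrite /rev_gates /stream /= => _ _ _ _ _ eA _.
  by apply: (exec_weaken (exec_while_nil _ _ eA)) => //; st_eq.
case/andP => /and3P[N0 /eqP s1 /eqP s2] ws eX eY eT eF eA zV.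
have := @exec_gate st rs g (stream gs) (st sB).
rewrite zV => /(_ s1 s2 _ erefl eX eY eT eF) e1.
apply: exec_weaken.
- apply: exec_while (e1 _) (IH _ _ _ _ _ _ _ _) => //.
  + by rewrite eA /stream /=; case: (g.1) s1 => //= s1; rewrite -s1 in N0.
  + by rewrite eA /stream /= catA.
  + by cbn; rewrite size_row_act // s1 zV.
- have -> : stream (rev_gates (g :: gs)) =
      stream (rev_gates gs) ++ rev g.1 ++ rev g.2.
    by rewrite /rev_gates /= rev_cons -cats1 stream_cat /stream /= cats0.
  move: (stream _) => u.
  apply: boolp.funext => i; rewrite /upd.
  by case: i => [//|[//|[|[//|i]]]] /=; rewrite ?catA.
- by [].
- lia.
Qed.

(* Both the gates and the resulting row are left in reverse order, so a second
   run undoes the circuit and restores the two stacks. *)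
Definition half_prog : prog :=
  Seq (While sA gate_prog) (Seq (mv sB sX) (Seq (mv sX sA)
    (Seq (mv sV sX) (Seq (mv sX sY) (mv sY sV))))).

Lemma size_stream N gs : well_sized N gs -> size (stream gs) = size gs * (2 * N).
Proof.
elim: gs => [|g gs IH] //= /andP[/and3P[_ /eqP s1 /eqP s2] /IH e].
by rewrite -cat1s stream_cat size_cat e /stream /= cats0 size_cat s1 s2; lia.
Qed.

Lemma well_sized_rev N gs : well_sized N gs -> well_sized N (rev_gates gs).
Proof.
by rewrite /well_sized all_rev all_map; apply: sub_all => g /=; rewrite !size_rev.
Qed.

Lemma size_rev_gates gs : size (rev_gates gs) = size gs.
Proof. by rewrite size_rev size_map. Qed.

Definition half_cost N G := G * (52 * N + 41) + 9 * N + 11.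

Lemma exec_half N st rs gs : well_sized N gs -> clean st ->
  st sA = stream gs -> size (st sV) = N ->
  exec half_prog st rs
    (upd (upd st sA (stream (rev_gates gs))) sV (rev (row_acts gs (st sV))))
    rs (half_cost N (size gs)).
Proof.
move=> ws cl eA zV; case/cleanP: (cl) => eB eX eY eT eF.
apply: exec_weaken.
- apply: (exec_seq (exec_circuit rs ws cl eA zV)).
  by do 4 (apply: exec_seq; [exact: exec_mv|]); exact: exec_mv.
- apply: boolp.funext => i; rewrite /upd.
  do 6 (destruct i as [|i]; [by cbn; rewrite ?eX ?eY ?eB ?eT ?eF ?catrevE ?cats0 ?revK|]).
  by [].
- by [].
- cbn; rewrite !catrevE eX eY !cats0 !size_rev.
  have -> := size_stream (well_sized_rev ws); rewrite size_rev_gates.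
  by have -> := size_row_acts ws zV; rewrite /half_cost; lia.
Qed.

(* A pass over the rows [a] and [sV] in parallel by a Mealy machine whose state
   is stack [r], rewriting the row [sV]. *)
Definition scan_step (a : nat) (f : bool -> bool -> prog) (x : bool) : prog :=
  Seq (Push sX x) (Pop sV Skip (f x false) (f x true)).

Definition scan (a : nat) (f : bool -> bool -> prog) : prog :=
  Seq (foreach a (scan_step a f)) (Seq (mv sX a) (mv sY sV)).

Section Mealy.
Variables (S : Type) (out : bool -> bool -> S -> bool).
Variable (next : bool -> bool -> S -> S).

Fixpoint mealy (a b : seq bool) (s : S) : seq bool * S :=
  match a, b with
  | x :: a', y :: b' =>
      let u := mealy a' b' (next x y s) in (out x y s :: u.1, u.2)
  | _, _ => ([::], s)
  end.

Lemma size_mealy a b s : size a = size b -> size (mealy a b s).1 = size b.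
Proof. by elim: a b s => [|x a IH] [|y b] s //= [e]; rewrite IH. Qed.

End Mealy.

(** The admissible stacks are listed explicitly so that every equation between stores splits into
    finitely many concrete cases. *)
Lemma exec_scan a r f out next c st rs N :
  a \in [:: sM; sJ; sZ] -> r \in [:: sF; sE] ->
  (forall x y st rs, exec (f x y) st rs
     (upd (upd st r (next x y (st r))) sY (out x y (st r) :: st sY)) rs c) ->
  size (st a) = N -> size (st sV) = N -> st sX = [::] -> st sY = [::] ->
  exec (scan a f) st rs
    (upd (upd st r (mealy out next (st a) (st sV) (st r)).2)
      sV (mealy out next (st a) (st sV) (st r)).1) rs
    (N * (c + 11) + 5).
Proof.
move=> ain rin ef za zV eX eY.
have e1 : exec (foreach a (scan_step a f)) st rs
  (upd (upd (upd (upd (upd st a [::]) sV [::]) sX (catrev (st a) (st sX)))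
    r (mealy out next (st a) (st sV) (st r)).2)
    sY (catrev (mealy out next (st a) (st sV) (st r)).1 (st sY))) rs
    (N * (c + 5) + 1).
  move: za zV {eX eY}; move ea: (st a) => la; move eV: (st sV) => lv za zV.
  rewrite -{}za in zV *.
  elim: la lv st ea eV zV => [|x la IH] [|y lv] st ea eV //= sz.
    apply: exec_weaken; [exact: (exec_foreach_nil _ _ ea) | | by [] | by []].
    move: ain rin ea eV; rewrite !inE.
    by case/or3P=> /eqP->; case/orP=> /eqP-> ea eV; st_eq.
  apply: exec_weaken.
  - apply: (exec_foreach_cons ea).
      apply: exec_seq; first exact: exec_push.
      apply: (@exec_pop sV Skip (f x) y lv); last exact: ef.
      by move: ain eV; rewrite !inE; case/or3P=> /eqP->.
    apply: (IH lv).
    + by move: ain rin; rewrite !inE; case/or3P=> /eqP->; case/orP=> /eqP->.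
    + by move: ain rin; rewrite !inE; case/or3P=> /eqP->; case/orP=> /eqP->.
    + by case: sz.
  - move: ain rin ea eV; rewrite !inE.
    by case/or3P=> /eqP->; case/orP=> /eqP-> ea eV; st_eq.
  - by [].
  - lia.
have sm : size (mealy out next (st a) (st sV) (st r)).1 = N.
  by rewrite size_mealy // za zV.
apply: exec_weaken.
- apply: (exec_seq e1); apply: exec_seq.
  + by apply: exec_mv; move: ain; rewrite !inE; case/or3P=> /eqP->.
  + exact: exec_mv.
- move: ain rin sm; rewrite !inE.
  case/or3P=> /eqP->; case/orP=> /eqP-> sm; apply: boolp.funext => i; rewrite /upd;
  by do 20 (destruct i as [|i];
    [by cbn; rewrite ?eX ?eY ?catrevE ?cats0 ?revK|]).
- by [].
- have -> : size (upd (upd (upd (upd (upd st a [::]) sV [::]) sX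
     (catrev (st a) (st sX)))
    r (mealy out next (st a) (st sV) (st r)).2)
    sY (catrev (mealy out next (st a) (st sV) (st r)).1 (st sY)) sX) = N.
    move: za ain rin; rewrite !inE => za.
    case/or3P=> /eqP ?; case/orP=> /eqP ?; subst; cbn; rewrite eX catrevE cats0 size_rev //.
  set z := size _.
  have -> : z = N.
    rewrite /z; move: za sm ain rin; rewrite !inE => za sm.
    case/or3P=> /eqP ?; case/orP=> /eqP ?; subst; cbn; rewrite eY !catrevE cats0 size_rev //.
  lia.
Qed.

(** * Passes over the wires *)

Definition allowed (h v : seq bool) : bool :=
  all (fun p => p.2 ==> p.1) (zip h v).

Definition parity (z v : seq bool) : bool :=
  foldr (fun p b => (p.1 && p.2) (+) b) false (zip z v).

(** A binary counter, low bit first, living on the positions marked by [j]; the other bits stay. The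
    last carry is dropped, so the counter is cyclic with period 2^([ones j]). *)
Fixpoint inc (carry : bool) (j v : seq bool) : seq bool :=
  match j, v with
  | x :: j', y :: v' =>
      if x then (y (+) carry) :: inc (y && carry) j' v'
      else y :: inc carry j' v'
  | _, _ => [::]
  end.

Definition mask0 (j v : seq bool) : seq bool :=
  [seq p.2 && ~~ p.1 | p <- zip j v].

(** Places the bits of [cs] on the marked positions in order, and zeros elsewhere or once [cs] is
    exhausted. *)
Fixpoint fill (j cs : seq bool) : seq bool :=
  match j, cs with
  | true :: j', c :: cs' => c :: fill j' cs'
  | x :: j', _ => false :: fill j' cs
  | _, _ => [::]
  end.

Definition ones (j : seq bool) : nat := count id j.

Lemma size_fill j cs : size (fill j cs) = size j.
Proof. by elim: j cs => [|[] j IH] [|c cs] //=; rewrite IH. Qed.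

Definition check_prog : prog :=
  scan sM (fun h v =>
    Seq (Push sY v) (if v && ~~ h then Push sF true else Skip)).

Lemma exec_check st rs N :
  size (st sM) = N -> size (st sV) = N -> clean st ->
  exists2 f, (f == 0) = allowed (st sM) (st sV) /\ f <= N &
  exec check_prog st rs (upd st sF (nseq f true)) rs (N * 14 + 5).
Proof.
move=> sm sv /cleanP[eB eX eY eT eF].
pose out (x y : bool) (s : seq bool) := y.
pose next (x y : bool) s := if y && ~~ x then true :: s else s.
have out1 h v s : size h = size v -> (mealy out next h v s).1 = v.
  by elim: h v s => [|x h IH] [|y v] s //= [e]; rewrite IH.
have [f lf next1] : exists2 f, (f == 0) = allowed (st sM) (st sV) /\ f <= N &
    (mealy out next (st sM) (st sV) [::]).2 = nseq f true.
  suff H h v g : exists2 f, (f == 0) = (g == 0) && allowed h v /\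
     f <= g + size h & (mealy out next h v (nseq g true)).2 = nseq f true.
    by have := H (st sM) (st sV) 0; rewrite eqxx sm.
  elim: h v g => [|x h IH] [|y v] g /=; rewrite /allowed /=;
    try by exists g; rewrite ?andbT //; split=> //; lia.
  have [f [f0 lf] e] := IH v (if y && ~~ x then g.+1 else g).
  exists f.
    split; last by move: lf; case: ifP; lia.
    by rewrite f0; case: (x); case: (y); rewrite //= andbF.
  by rewrite -e /next; case: ifP.
exists f => //; apply: exec_weaken.
- apply: (@exec_scan sM sF _ out next 3 st rs N) => // x y st' rs'.
  rewrite /out /next; case: (y); case: (x) => /=;
  by apply: exec_weaken; [by ex | by st_eq | by [] | by []].
- by rewrite eF next1 out1 ?sm //; st_eq.
- by [].
- lia.
Qed.

Definition parity_prog : prog :=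
  scan sZ (fun z v =>
    Seq (Push sY v)
      (if z && v then Pop sE (Push sE true) Skip Skip else Skip)).

Lemma exec_parity st rs N :
  size (st sZ) = N -> size (st sV) = N -> clean st -> st sE = [::] ->
  exec parity_prog st rs
    (upd st sE (nseq (parity (st sZ) (st sV)) true)) rs (N * 15 + 5).
Proof.
move=> sm sv /cleanP[eB eX eY eT eF] eE.
pose out (x y : bool) (s : seq bool) := y.
pose next (x y : bool) s :=
  if x && y then if s is [::] then [:: true] else behead s else s.
have out1 h v s : size h = size v -> (mealy out next h v s).1 = v.
  by elim: h v s => [|x h IH] [|y v] s //= [e]; rewrite IH.
have next1 h v (b : bool) :
    (mealy out next h v (nseq b true)).2 = nseq (b (+) parity h v) true.
  elim: h v b => [|x h IH] [|y v] b /=; rewrite /parity /= ?addbF //.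
  have -> : next x y (nseq b true) = nseq ((x && y) (+) b) true.
    by case: (x); case: (y); case: b.
  by rewrite IH; congr (nseq (nat_of_bool _) _); rewrite addbA [b (+) _]addbC.
apply: exec_weaken.
- apply: (@exec_scan sZ sE _ out next 4 st rs N) => // x y st' rs'.
  rewrite /out /next; case: (y); case: (x); case e: (st' sE) => [|[] l] /=;
  by apply: exec_weaken; [by ex | by st_eq | by [] | by []].
- by rewrite eE (next1 _ _ false) out1 ?sm //; st_eq.
- by [].
- lia.
Qed.

(** The carry is the presence of a mark on [sF]. The branches for a popped 0 never occur here; they
    are written so that the machine obeys its transition function on every store, as [exec_scan]
    asks. *)
Definition inc_prog : prog :=
  Seq (Push sF true)
    (Seq (scan sJ (fun j v =>
      if j then
        if v then Pop sF (Push sY true) (Seq (Push sF false) (Push sY false))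
                    (Seq (Push sF true) (Push sY false))
        else Pop sF (Push sY false) (Push sY true) (Push sY true)
      else Push sY v))
    (clear sF)).

Lemma exec_inc st rs N :
  size (st sJ) = N -> size (st sV) = N -> clean st ->
  exec inc_prog st rs (upd st sV (inc true (st sJ) (st sV))) rs (N * 15 + 20).
Proof.
move=> sm sv /cleanP[eB eX eY eT eF].
pose out (x y : bool) (s : seq bool) := if x then y (+) ~~ nilp s else y.
pose next (x y : bool) (s : seq bool) := if x && ~~ y then behead s else s.
have out1 h v (b : bool) : size h = size v ->
    (mealy out next h v (nseq b true)).1 = inc b h v.
  elim: h v b => [|x h IH] [|y v] b //= [e].
  rewrite {1}/out.
  have -> : next x y (nseq b true) = nseq (if x then y && b else b) true.
    by case: (x); case: (y); case: b.
  by rewrite IH //; case: (x); case: b.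
have next1 h v (b : bool) : size (mealy out next h v (nseq b true)).2 <= 1.
  elim: h v b => [|x h IH] [|y v] b /=; try by case: b.
  have -> : next x y (nseq b true) = nseq (if x then y && b else b) true.
    by case: (x); case: (y); case: b.
  exact: IH.
apply: exec_weaken.
- apply: exec_seq; first exact: exec_push.
  apply: exec_seq; last exact: exec_clear.
  apply: (@exec_scan sJ sF _ out next 4 _ rs N) => // x y st' rs'.
  rewrite /out /next; case: (y); case: (x); case e: (st' sF) => [|[] l] /=;
  by apply: exec_weaken; [by ex | by st_eq | by [] | by []].
- cbn; rewrite eF (out1 _ _ true) ?sm //.
  by move: (mealy _ _ _ _ _) => u; st_eq.
- by [].
- cbn; rewrite eF; have := next1 (st 10) (st 3) true.
  by move: (size _) => u; lia.
Qed.

Definition mask0_prog : prog := scan sJ (fun j v => Push sY (v && ~~ j)).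

Lemma exec_mask0 st rs N :
  size (st sJ) = N -> size (st sV) = N -> clean st ->
  exec mask0_prog st rs (upd st sV (mask0 (st sJ) (st sV))) rs (N * 12 + 5).
Proof.
move=> sm sv /cleanP[eB eX eY eT eF].
pose out (x y : bool) (s : seq bool) := y && ~~ x.
pose next (x y : bool) (s : seq bool) := s.
have out1 h v s : (mealy out next h v s).1 = mask0 h v.
  by elim: h v s => [|x h IH] [|y v] s //=; rewrite IH.
have next1 h v s : (mealy out next h v s).2 = s.
  by elim: h v s => [|x h IH] [|y v] s //=.
apply: exec_weaken.
- apply: (@exec_scan sJ sF _ out next 1 _ rs N) => // x y st' rs' /=.
  by apply: exec_weaken; [by ex | by rewrite /next /out; st_eq | by [] | by []].
- by rewrite out1 next1; st_eq.
- by [].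
- lia.
Qed.

Definition toss_row (a b : nat) : prog :=
  Seq (foreach a (fun j =>
         Seq (Push sX j) (if j then Toss sY else Push sY false)))
    (Seq (mv sX a) (mv sY b)).

Lemma exec_toss_row a b st rs cs :
  (a, b) \in [:: (sM, sV); (sJ, sZ)] -> clean st -> st b = [::] ->
  size cs = ones (st a) ->
  exec (toss_row a b) st (cs ++ rs) (upd st b (fill (st a) cs)) rs
    (size (st a) * 11 + 5).
Proof.
move=> ab /cleanP[eB eX eY eT eF] eb sc.
have e1 : exec (foreach a (fun j =>
         Seq (Push sX j) (if j then Toss sY else Push sY false))) st (cs ++ rs)
   (upd (upd (upd st a [::]) sX (catrev (st a) (st sX)))
      sY (catrev (fill (st a) cs) (st sY))) rs (size (st a) * 5 + 1).
  move ea: (st a) sc => la sc {eX eY eb}.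
  elim: la cs st ea sc {eB eT eF} => [|x la IH] cs st ea /= sc.
    case: cs sc => //= _.
    apply: exec_weaken; [exact: (exec_foreach_nil _ _ ea) | | by [] | by []].
    by move: ab ea; rewrite !inE; case/orP=> /eqP[-> _] ea; st_eq.
  have [c [ds [ecs eds sds]]] : exists c ds,
    [/\ cs = (if x then c :: ds else ds), fill (x :: la) cs = c :: fill la ds,
      size ds = ones la & ~~ x -> c = false].
    case: x sc {ea} => /= sc; last by exists false, cs; split => //; case: (cs).
    by case: cs sc => // c ds [sds]; exists c, ds.
  move=> c0.
  rewrite -[match x with true => _ | false => _ end]/(fill (x :: la) cs).
  rewrite eds.
  apply: exec_weaken.
  - apply: (exec_foreach_cons ea).
      instantiate (1 := 3); instantiate (1 := ds ++ rs).
      instantiate (1 := upd (upd (upd st a la) sX (x :: st sX)) sY (c :: st sY)).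
      rewrite ecs; move: ab c0 ea; rewrite !inE.
      case/orP=> /eqP[-> _]; case: (x) => c0 ea;
      try rewrite (c0 isT); cbn iota;
      by apply: exec_weaken; [by ex | by st_eq | by [] | by []].
    apply: (IH ds) => //.
    by move: ab; rewrite !inE; case/orP=> /eqP[-> _].
  - move: ab ea; rewrite !inE.
    by case/orP=> /eqP[-> _] ea; st_eq.
  - by [].
  - lia.
apply: exec_weaken.
- apply: (exec_seq e1); apply: exec_seq.
  + by apply: exec_mv; move: ab; rewrite !inE; case/orP=> /eqP[-> _].
  + by apply: exec_mv; move: ab; rewrite !inE; case/orP=> /eqP[_ ->].
- move: ab eb; rewrite !inE.
  case/orP=> /eqP[-> ->] eb; apply: boolp.funext => i; rewrite /upd;
  by do 20 (destruct i as [|i];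
    [by cbn; rewrite ?eX ?eY ?eb ?catrevE ?cats0 ?revK|]).
- by [].
- move: ab sc; rewrite !inE; case/orP=> /eqP[-> _] sc;
  cbn; rewrite eX eY !catrevE !cats0 !size_rev size_fill; lia.
Qed.

(** * One term of the amplitude *)

Definition target_free_row (g : row_gate) : bool :=
  ~~ has (fun p => p.1 && p.2) (zip g.1 g.2).

(** Flipping the target leaves the controls unchanged, so the gate is enabled both times or neither
    time. *)
Lemma row_actK g w : size g.1 = size w -> size g.2 = size w ->
  target_free_row g -> row_act (row_act w g) g = w.
Proof.
case: g => t c /= st sc; rewrite /target_free_row /= => free.
have en ok : enabled c (flip ok t w) = enabled c w.
  elim: w t c st sc free => [|x w IH] [|y t] [|z c] //= [st] [sc].
  rewrite negb_or /enabled /= => /andP[yz /(IH t c st sc) e]; congr andb => //.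
  by move: yz; case: y; case: z; rewrite ?addbF.
rewrite /row_act /= en.
rewrite /flip; move: (enabled c w) => ok; elim: w t st {sc free en} => [|x w IH] [|y t] //= [st].
by rewrite IH // -addbA addbb addbF.
Qed.

Lemma row_act_rev g w : size g.1 = size w -> size g.2 = size w ->
  row_act (rev w) (rev_gate g) = rev (row_act w g).
Proof.
move=> st sc; rewrite /row_act rev_flip //=; congr flip.
by rewrite /enabled -rev_zip // all_rev.
Qed.

Lemma rev_gatesK gs : rev_gates (rev_gates gs) = gs.
Proof.
rewrite /rev_gates map_rev revK -map_comp -[RHS]map_id; apply: eq_map => -[t c].
by rewrite /rev_gate /= !revK.
Qed.

(** Induction on the gates: the inverse circuit ends with the first gate, which cancels itself. *)
Lemma row_acts_rev N gs v : well_sized N gs -> all target_free_row gs ->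
  size v = N -> row_acts (rev_gates gs) (rev (row_acts gs v)) = rev v.
Proof.
elim: gs v => [|g gs IH] v //= /andP[/and3P[_ /eqP s1 /eqP s2] ws].
case/andP=> fg fgs sv.
rewrite /rev_gates /= rev_cons /row_acts foldl_rcons -/(row_acts _ _).
rewrite -/(row_acts gs _) -/(rev_gates gs) IH // ?size_row_act ?s1 ?sv //.
by rewrite row_act_rev ?size_row_act ?s1 ?s2 ?sv // row_actK ?s1 ?s2 ?sv.
Qed.

(* The net count of signs in unary: the smaller of the two numbers is 0. *)
Definition signed_tally (ok odd : bool) (pn : nat * nat) : nat * nat :=
  if ok then
    if odd then if pn.1 is p.+1 then (p, pn.2) else (0, pn.2.+1)
    else if pn.2 is n.+1 then (pn.1, n) else (pn.1.+1, 0)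
  else pn.

Definition tally_prog : prog :=
  Pop sF (Pop sE (Pop sN (Push sP true) Skip Skip)
                 Skip
                 (Pop sP (Push sN true) Skip Skip))
    Skip (Seq (clear sF) (clear sE)).

Lemma exec_tally st rs f (b : bool) pn :
  st sF = nseq f true -> st sE = nseq b true ->
  st sP = nseq pn.1 true -> st sN = nseq pn.2 true ->
  exec tally_prog st rs
    (upd (upd (upd (upd st sF [::]) sE [::])
      sP (nseq (signed_tally (f == 0) b pn).1 true))
      sN (nseq (signed_tally (f == 0) b pn).2 true)) rs (3 * f + 10).
Proof.
rewrite /tally_prog; case: pn => p n /= eF eE eP eN.
have S k : nseq k.+1 true = true :: nseq k true by [].
case: f eF => [|f] eF.
  case: b eE => /= eE; [case: p eP => [|p] eP | case: n eN => [|n] eN];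
    rewrite ?S in eP eN; (apply: exec_weaken; [by ex | | by [] | by lia]);
    apply: boolp.funext => i; rewrite /upd;
    by do 20 (destruct i as [|i]; [by cbn; rewrite ?eF ?eE ?eP ?eN|]).
rewrite S in eF; apply: exec_weaken; [by ex | | by [] |].
  by apply: boolp.funext => i; rewrite /upd /signed_tally -eP -eN;
    do 20 (destruct i as [|i]; [by []|]).
by cbn; rewrite eE !size_nseq; case: (b); lia.
Qed.

(** Applied with [gs] the reversed circuit and [v] a reversed row: it tests that the preimage of the
    basis state is 0 on the wires without Hadamard gate. The [rev] restores the orientation of
    [h]. *)
Definition valid (gs : seq row_gate) (h v : seq bool) : bool :=
  allowed h (rev (row_acts gs v)).

Definition visit_prog : prog :=
  Seq parity_prog (Seq half_prog (Seq check_prog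
    (Seq tally_prog (Seq half_prog inc_prog)))).

Definition visit_cost N G := 2 * half_cost N G + 50 * N + 60.

Lemma size_inc b j v : size j = size v -> size (inc b j v) = size v.
Proof.
by elim: j v b => [|x j IH] [|y v] b //= [e]; case: x; rewrite /= IH.
Qed.

Lemma exec_visit N st rs gs h j z v pn :
  well_sized N gs -> all target_free_row gs -> clean st ->
  st sA = stream gs -> st sM = h -> st sJ = j -> st sZ = z -> st sV = v ->
  size h = N -> size j = N -> size z = N -> size v = N -> st sE = [::] ->
  st sP = nseq pn.1 true -> st sN = nseq pn.2 true ->
  exec visit_prog st rs
    (upd (upd (upd st sV (inc true j v))
      sP (nseq (signed_tally (valid gs h v) (parity z v) pn).1 true))
      sN (nseq (signed_tally (valid gs h v) (parity z v) pn).2 true)) rs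
    (visit_cost N (size gs)).
Proof.
move=> ws fr cl eA eM eJ eZ eV zh zj zz zv eE eP eN.
case/cleanP: (cl) => eB eX eY eT eF.
have e1 := @exec_parity st rs N (etrans (congr1 size eZ) zz)
  (etrans (congr1 size eV) zv) cl eE.
rewrite eZ eV in e1; set st1 := upd _ _ _ in e1.
have e2 := @exec_half N st1 rs gs ws cl eA (etrans (congr1 size eV) zv).
rewrite [st1 sV]eV in e2; set u := rev _ in e2; set st2 := upd _ _ _ in e2.
have zu : size u = N by rewrite size_rev (size_row_acts ws).
have [|//||f [f0 lf] e3] := @exec_check st2 rs N.
- by rewrite -zh -eM.
- exact: cl.
rewrite [st2 sM]eM [st2 sV]/= in f0.
set st3 := upd _ _ _ in e3.
have e4 := @exec_tally st3 rs f (parity z v) pn erefl erefl eP eN.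
set pn' := signed_tally _ _ _ in e4.
set st4 := upd _ sN _ in e4.
(* The second pass runs the inverse circuit, so the row and the gates come back without having been
   saved. *)
have e5 := @exec_half N st4 rs (rev_gates gs) (well_sized_rev ws) _ erefl zu.
rewrite [st4 sV]/= (row_acts_rev ws fr zv) revK size_rev_gates in e5.
rewrite rev_gatesK in e5.
set st5 := upd _ _ _ in e5.
have e6 := @exec_inc st5 rs N (etrans (congr1 size eJ) zj) zv.
set st6 := upd _ _ _ in e6.
apply: exec_weaken.
- apply: (exec_seq e1 (exec_seq e2 (exec_seq e3 (exec_seq e4
    (exec_seq (e5 _) (e6 _)))))).
  + by rewrite /clean /st4 /st3 /st2 /st1 /upd /= eX eY eT eB.
  + by rewrite /clean /st5 /st4 /st3 /st2 /st1 /upd /= eX eY eT eB.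
- rewrite /valid -/u -f0 -/pn'; rewrite /st6 [st5 sJ]eJ [st5 sV]/=.
  apply: boolp.funext => i; rewrite /upd.
  by do 20 (destruct i as [|i]; [by cbn; rewrite ?eA ?eF ?eE|]).
- by [].
- by rewrite /visit_cost; lia.
Qed.

(** * Counting and randomized halving *)

(** Loop rule for a unary counter: [F] and [T] are the trajectories of the store and of the tape.
    Induction is on the number of iterations left, since the loop unfolds at its front. *)
Lemma exec_repeat s body c q (F : nat -> store) (T : nat -> seq bool) :
  (forall i, i <= q -> F i s = nseq (q - i) true) ->
  (forall i, i < q -> exec (body true)
     (upd (F i) s (nseq (q - i.+1) true)) (T i) (F i.+1) (T i.+1) c) ->
  exec (foreach s body) (F 0) (T 0) (F q) (T q) (q * (c + 2) + 1).
Proof.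
move=> Fs Fb.
suff H k : k <= q ->
    exec (foreach s body) (F (q - k)) (T (q - k)) (F q) (T q) (k * (c + 2) + 1).
  by have := H q (leqnn q); rewrite subnn.
elim: k => [|k IH] lk.
  by rewrite subn0; apply: exec_foreach_nil; rewrite Fs // subnn.
have E : q - k = (q - k.+1).+1 by lia.
apply: exec_weaken.
- apply: (@exec_foreach_cons s body true (nseq k true)).
  + by rewrite Fs ?leq_subr // subKn.
  + have := Fb (q - k.+1); rewrite -E subKn; last exact: ltnW.
    by apply; lia.
  + by apply: IH; exact: ltnW.
- by [].
- by [].
- by lia.
Qed.

Lemma nseqS k : nseq k.+1 true = true :: nseq k true.
Proof. by []. Qed.

Lemma catrev_nseq q k : catrev (nseq q true) (nseq k true) = nseq (q + k) true.
Proof. by elim: q k => [|q IH] k //=; rewrite (IH k.+1) addnS. Qed.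

Definition visit (gs : seq row_gate) (h j z : seq bool)
    (s : seq bool * (nat * nat)) : seq bool * (nat * nat) :=
  (inc true j s.1, signed_tally (valid gs h s.1) (parity z s.1) s.2).

(** [sR] collects the marks of the counter [sQ], to be restored for the next trial. *)
Definition enumerate_prog : prog :=
  Seq (foreach sQ (fun q => Seq (Push sR q) visit_prog)) (mv sR sQ).

Ltac by_stack tac :=
  apply: boolp.funext => ?;
  match goal with i : nat |- _ =>
    rewrite /upd; by do 20 (destruct i as [|i]; [by cbn; tac|]) end.

Lemma exec_enumerate N st rs gs h j z v q :
  well_sized N gs -> all target_free_row gs -> clean st ->
  st sA = stream gs -> st sM = h -> st sJ = j -> st sZ = z -> st sV = v ->
  size h = N -> size j = N -> size z = N -> size v = N -> st sE = [::] ->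
  st sP = [::] -> st sN = [::] -> st sQ = nseq q true -> st sR = [::] ->
  let s := iter q (visit gs h j z) (v, (0, 0)) in
  exec enumerate_prog st rs
    (upd (upd (upd st sV s.1) sP (nseq s.2.1 true)) sN (nseq s.2.2 true)) rs
    (q * (visit_cost N (size gs) + 7) + 3).
Proof.
move=> ws fr cl eA eM eJ eZ eV zh zj zz zv eE eP eN eQ eR s.
pose F i := let s := iter i (visit gs h j z) (v, (0, 0)) in
  upd (upd (upd (upd (upd st sQ (nseq (q - i) true)) sR (nseq i true)) sV s.1)
    sP (nseq s.2.1 true)) sN (nseq s.2.2 true).
have zF i : size (iter i (visit gs h j z) (v, (0, 0))).1 = N.
  by elim: i => //= i IH; rewrite size_inc ?IH.
have e1 : exec (foreach sQ (fun q => Seq (Push sR q) visit_prog)) (F 0) rs (F q) rs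
    (q * (visit_cost N (size gs) + 2 + 2) + 1).
  apply: (@exec_repeat _ _ _ q F (fun=> rs)) => // i lt.
  apply: exec_weaken.
  - apply: exec_seq; first exact: exec_push.
    by apply: (@exec_visit N _ _ gs h j z
      (iter i (visit gs h j z) (v, (0, 0))).1
      (iter i (visit gs h j z) (v, (0, 0))).2) => //; exact: zF.
  - rewrite /F; by_stack idtac.
  - by [].
  - lia.
have F0 : F 0 = st.
  by rewrite /F subn0; by_stack ltac:(rewrite ?eQ ?eR ?eV ?eP ?eN).
rewrite F0 in e1.
apply: exec_weaken; [apply: exec_seq e1 _; exact: exec_mv | | by [] |].
- by rewrite /F subnn; cbn; rewrite (catrev_nseq q 0) addn0; by_stack ltac:(rewrite ?eR ?eQ).
- by rewrite /F subnn; cbn; rewrite size_nseq; lia.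
Qed.

(** Two marks are exchanged for one; an odd last mark finds the stack empty and is dropped, which
    rounds down. *)
Definition halve_prog : prog :=
  Seq (foreach sE (fun=> Pop sE Skip (Push sY true) (Push sY true))) (mv sY sE).

Lemma exec_halve st rs d : st sE = nseq d true -> st sY = [::] ->
  exec halve_prog st rs (upd st sE (nseq d./2 true)) rs (7 * d + 7).
Proof.
move=> eE eY; rewrite -[d]odd_double_half in eE *.
rewrite half_bit_double; move: (odd d) d./2 eE => b k eE.
have e1 : exec (foreach sE (fun=> Pop sE Skip (Push sY true) (Push sY true)))
    st rs (upd (upd st sE [::]) sY (nseq k true)) rs (4 * (b + k.*2) + 1).
  suff H l st' : st' sE = nseq (b + k.*2) true -> st' sY = nseq l true ->
    exec (foreach sE (fun=> Pop sE Skip (Push sY true) (Push sY true)))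
    st' rs (upd (upd st' sE [::]) sY (nseq (k + l) true)) rs
    (4 * (b + k.*2) + 1) by rewrite -[k in nseq k _]addn0; exact: H.
  elim: k l st' {eE eY} => [|k IH] l st' eE eY.
    have eN : exec (foreach sE (fun=> Pop sE Skip (Push sY true) (Push sY true)))
      (upd st' sE [::]) rs (upd st' sE [::]) rs 1 by exact: exec_foreach_nil.
    case: b eE => /= eE; last first.
      apply: exec_weaken; [exact: exec_foreach_nil eE | | by [] | by []].
      by by_stack ltac:(rewrite ?eE ?eY).
    apply: exec_weaken.
    + apply: exec_foreach_cons eE _ eN; apply: exec_pop_nil => //; exact: exec_skip.
    + by by_stack ltac:(rewrite ?eE ?eY).
    + by [].
    + by [].
  rewrite doubleS !addnS !nseqS in eE.
  apply: exec_weaken.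
  - apply: exec_foreach_cons eE _ (IH l.+1 _ _ _).
    + by apply: exec_pop1 => //; exact: exec_push.
    + by [].
    + by cbn; rewrite eY.
  - by rewrite addnS; by_stack idtac.
  - by [].
  - by lia.
apply: exec_weaken; [apply: exec_seq e1 _; exact: exec_mv | | by [] |].
- cbn; rewrite (catrev_nseq k 0) addn0; by_stack ltac:(rewrite ?eY).
- by cbn; rewrite size_nseq; lia.
Qed.

Definition round_prog : prog :=
  Seq (Toss sF) (Seq (Pop sF Skip Skip (Push sE true)) halve_prog).

Lemma exec_round st rs d (c : bool) :
  st sE = nseq d true -> st sY = [::] -> st sF = [::] ->
  exec round_prog st (c :: rs) (upd st sE (nseq (d + c)./2 true)) rs (7 * d + 20).
Proof.
move=> eE eY eF.
apply: exec_weaken.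
- apply: exec_seq; first exact: exec_toss.
  apply: exec_seq.
    instantiate (1 := 2); instantiate (1 := rs).
    instantiate (1 := upd st sE (nseq (d + c) true)).
    case: c; rewrite ?addn1 ?addn0 eF.
      apply: exec_weaken; [by ex | | by [] | by []].
      by by_stack ltac:(rewrite ?eE ?eF).
    apply: exec_weaken; [by ex | | by [] | by []].
    by by_stack ltac:(rewrite ?eE ?eF).
  by apply: exec_halve.
- by by_stack idtac.
- by [].
- by case: c; lia.
Qed.

Definition randomized_halving (d : nat) (cs : seq bool) : nat :=
  foldl (fun d c => (d + nat_of_bool c)./2) d cs.

(** The mask [sJ] itself serves as the counter: one round per marked wire. *)
Definition rounds_prog : prog :=
  Seq (foreach sJ (fun j => Seq (Push sX j) (if j then round_prog else Skip)))
    (mv sX sJ).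

Lemma exec_rounds st rs d cs :
  st sE = nseq d true -> clean st -> size cs = ones (st sJ) ->
  exec rounds_prog st (cs ++ rs)
    (upd st sE (nseq (randomized_halving d cs) true)) rs
    (size (st sJ) * (7 * d + 27) + 3).
Proof.
move=> eE /cleanP[eB eX eY eT eF] zc.
have e1 : exec (foreach sJ (fun j =>
        Seq (Push sX j) (if j then round_prog else Skip))) st (cs ++ rs)
   (upd (upd (upd st sJ [::]) sX (catrev (st sJ) (st sX)))
      sE (nseq (randomized_halving d cs) true)) rs
   (size (st sJ) * (7 * d + 24) + 1).
  (* A round never increases the count, so each is charged at a fixed upper bound [m]. *)
  suff H m : d <= m -> exec (foreach sJ (fun j =>
        Seq (Push sX j) (if j then round_prog else Skip))) st (cs ++ rs)
   (upd (upd (upd st sJ [::]) sX (catrev (st sJ) (st sX)))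
      sE (nseq (randomized_halving d cs) true)) rs
   (size (st sJ) * (7 * m + 24) + 1) by exact: H.
  move ej : (st sJ) zc => j zc.
  elim: j d cs st ej eE eY eF zc {eB eX eT}
    => [|x j IH] d cs st ej eE eY eF zc ld.
    case: cs zc => //= _.
    apply: exec_weaken; [exact: (exec_foreach_nil _ _ ej) | | by [] | by []].
    by by_stack ltac:(rewrite ?ej ?eE).
  case: x ej zc => ej /= zc.
    case: cs zc => // c cs /= [zc].
    apply: exec_weaken.
    - apply: exec_foreach_cons ej _ (IH (d + c)./2 cs _ _ _ _ _ zc _) => //.
      1: by apply: exec_seq; [exact: exec_push | exact: (@exec_round _ _ d)].
      all: try by [].
      by apply: (leq_trans _ ld); rewrite leq_half_double -addnn; case: (c) => /=; lia.
    - by by_stack idtac.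
    - by lia.
  apply: exec_weaken.
  - apply: exec_foreach_cons ej _ (IH d cs _ _ _ _ _ zc _) => //.
    1: by apply: exec_seq; [exact: exec_push | exact: exec_skip].
    all: try by [].
  - by by_stack idtac.
  - by lia.
apply: exec_weaken; [apply: exec_seq e1 _; exact: exec_mv | | by [] |].
- by_stack ltac:(rewrite ?eX ?catrevE ?cats0 ?revK).
- by cbn; rewrite eX catrevE cats0 size_rev; lia.
Qed.

Definition copy_prog : prog :=
  Seq (foreach sD (fun=> Seq (Push sX true) (Push sE true))) (mv sX sD).

Lemma exec_copy st rs d :
  st sD = nseq d true -> st sX = [::] -> st sE = [::] ->
  exec copy_prog st rs (upd st sE (nseq d true)) rs (8 * d + 3).
Proof.
move=> eD eX eE.
pose F i := upd (upd (upd st sD (nseq (d - i) true)) sX (nseq i true))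
  sE (nseq i true).
have e1 : exec (foreach sD (fun=> Seq (Push sX true) (Push sE true)))
    (F 0) rs (F d) rs (d * (3 + 2) + 1).
  apply: (@exec_repeat _ _ _ d F (fun=> rs)) => // i lt.
  apply: exec_weaken; [by ex | | by [] | by []].
  by rewrite /F; by_stack idtac.
have F0 : F 0 = st by rewrite /F subn0; by_stack ltac:(rewrite ?eD ?eX ?eE).
rewrite F0 in e1.
apply: exec_weaken; [apply: exec_seq e1 _; exact: exec_mv | | by [] |].
- rewrite /F subnn; cbn; rewrite (catrev_nseq d 0) addn0.
  by_stack ltac:(rewrite ?eX ?eD).
- by rewrite /F subnn; cbn; rewrite size_nseq; lia.
Qed.

(** * One rejection-sampling trial *)

Lemma randomized_halving_le d cs : randomized_halving d cs <= d.
Proof.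
elim: cs d => [|c cs IH] d //=; apply: leq_trans (IH _) _.
by rewrite leq_half_double -addnn; case: c => /=; lia.
Qed.

(** The absolute value of the signed sum: one of the two counters is 0, so their sum is the absolute
    value of their difference. *)
Definition net (gs : seq row_gate) (h j v : seq bool) (q : nat)
    (z : seq bool) : nat :=
  let s := iter q (visit gs h j z) (v, (0, 0)) in s.2.1 + s.2.2.

Lemma net_le gs h j v q z : net gs h j v q z <= q.
Proof.
rewrite /net; elim: q => //= q; case: (iter _ _ _) => u [p n] /=.
rewrite /signed_tally; case: ifP => _ //=; last by lia.
by case: ifP => _; [case: p => [|p] | case: n => [|n]] => /=; lia.
Qed.

(** Two independent events of probability d / 2^k give the square. After a first failure the count
    becomes 0 instead of the second block being skipped: 0 is fixed by randomized halving, and the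
    number of coins read stays the same. *)
Definition accept (d : nat) (cs cs' : seq bool) : bool :=
  0 < randomized_halving (if randomized_halving d cs == 0 then 0 else d) cs'.

Definition trial_prog : prog :=
  Seq (toss_row sJ sZ) (Seq enumerate_prog (Seq (mv sP sD) (Seq (mv sN sD)
  (Seq copy_prog (Seq rounds_prog (Seq (Pop sE (clear sD) Skip (clear sE))
  (Seq (mv sD sE) (Seq rounds_prog
    (Pop sE (clear sZ) Skip
      (Seq (clear sE) (Seq (clear sS) (Seq (mv sZ sX) (mv sX sS))))))))))))).

Definition trial_cost N G q :=
  q * (visit_cost N G + 7) + 2 * (N * (7 * q + 27)) + 40 * q + 40 * N + 80.

Lemma iter_visit q gs h j z v pn :
  (iter q (visit gs h j z) (v, pn)).1 = iter q (inc true j) v.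
Proof. by elim: q => //= q ->. Qed.

(** Invariant of the trial loop. It leaves out the loop counter [sL] and the accepted string [sS],
    which change, and the stacks [sK] and [sO], which a trial does not touch. *)
Definition ready (st : store) (gs : seq row_gate) (h j v : seq bool) q :=
  [/\ clean st, st sA = stream gs, st sM = h, st sJ = j & st sV = v] /\
  [/\ st sZ = [::], st sQ = nseq q true & st sR = [::]] /\
  [/\ st sP = [::], st sN = [::], st sD = [::] & st sE = [::]].

(** The hypothesis that [q] increments fix [v] says that the enumeration goes full circle; this
    restores the row, so that only [sS] differs at the end. *)
Lemma exec_trial N st rs gs h j v q c1 c2 c3 :
  well_sized N gs -> all target_free_row gs ->
  size h = N -> size j = N -> size v = N -> size (st sS) <= N ->
  iter q (inc true j) v = v -> ready st gs h j v q ->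
  size c1 = ones j -> size c2 = ones j -> size c3 = ones j ->
  let z := fill j c1 in
  exec trial_prog st (c1 ++ c2 ++ c3 ++ rs)
    (upd st sS (if accept (net gs h j v q z) c2 c3 then z else st sS)) rs
    (trial_cost N (size gs) q).
Proof.
move=> ws fr zh zj zv zS cyc [[cl eA eM eJ eV] [[eZ eQ eR] [eP eN eD eE]]].
move=> zc1 zc2 zc3 z.
have zz : size z = N by rewrite size_fill.
case/cleanP: (cl) => eB eX eY eT eF.
have e1 := @exec_toss_row sJ sZ st (c2 ++ c3 ++ rs) c1 erefl cl eZ
  (etrans zc1 (congr1 ones (esym eJ))).
rewrite eJ -/z zj in e1; set st1 := upd _ _ _ in e1.
have e2 := @exec_enumerate N st1 (c2 ++ c3 ++ rs) gs h j z v q ws fr cl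
  eA eM eJ erefl eV zh zj zz zv eE eP eN eQ eR.
rewrite /= iter_visit cyc in e2.
have := net_le gs h j v q z; rewrite /net /accept /=.
move: (iter _ _ _).2 e2 => [p n] /= e2 lq; set st2 := upd _ sN _ in e2.
have e3 := @exec_mv sP sD st2 (c2 ++ c3 ++ rs) isT.
rewrite [st2 sP]/= [st2 sD]eD (catrev_nseq p 0) addn0 size_nseq in e3.
set st3 := upd _ sD _ in e3.
have e4 := @exec_mv sN sD st3 (c2 ++ c3 ++ rs) isT.
rewrite [st3 sN]/= [st3 sD]/= catrev_nseq size_nseq addnC in e4.
set d := p + n in lq e4 *.
set st4 := upd _ sD _ in e4.
have e5 := @exec_copy st4 (c2 ++ c3 ++ rs) d erefl eX eE.
set st5 := upd _ sE _ in e5.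
have e6 := @exec_rounds st5 (c3 ++ rs) d c2 erefl cl
  (etrans zc2 (congr1 ones (esym eJ))).
rewrite [st5 sJ]eJ zj in e6.
set d1 := randomized_halving d c2 in e6 *.
have ld1 : d1 <= d by exact: randomized_halving_le.
set st6 := upd _ sE _ in e6.
pose d2 := if d1 == 0 then 0 else d.
pose st7 := upd (upd st6 sE [::]) sD (nseq d2 true).
have e7 : exec (Pop sE (clear sD) Skip (clear sE)) st6 (c3 ++ rs)
    st7 (c3 ++ rs) (3 * q + 2).
  rewrite /st7 /d2; case ed: d1 => [|k] /=.
    apply: exec_weaken; [apply: exec_pop_nil; [by rewrite /st6 ed | exact: exec_clear] | | by [] |].
      by rewrite /st6 ed; by_stack idtac.
    by rewrite /st6; cbn; rewrite size_nseq; lia.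
  apply: exec_weaken; [apply: (@exec_pop1 _ _ _ _ (nseq k true));
    [by rewrite /st6 ed | exact: exec_clear] | | by [] |].
    by by_stack idtac.
  by cbn; rewrite size_nseq; lia.
have e8 := @exec_mv sD sE st7 (c3 ++ rs) isT.
rewrite [st7 sD]/= [st7 sE]/= (catrev_nseq d2 0) addn0 size_nseq in e8.
set st8 := upd _ sE _ in e8.
have ld2 : d2 <= q by rewrite /d2; case: ifP.
have e9 := @exec_rounds st8 rs d2 c3 erefl cl
  (etrans zc3 (congr1 ones (esym eJ))).
rewrite [st8 sJ]eJ zj in e9.
rewrite -/d2; set d3 := randomized_halving d2 c3 in e9 *.
have ld3 : d3 <= d2 by exact: randomized_halving_le.
set st9 := upd _ sE _ in e9.
pose st' := upd st sS (if 0 < d3 then z else st sS).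
have e10 : exec (Pop sE (clear sZ) Skip
      (Seq (clear sE) (Seq (clear sS) (Seq (mv sZ sX) (mv sX sS)))))
    st9 rs st' rs (12 * N + 3 * q + 20).
  rewrite /st'; case ed: d3 => [|k].
    apply: exec_weaken; [apply: exec_pop_nil; [by rewrite /st9 ed | exact: exec_clear] | | by [] |].
      rewrite /st9 ed; by_stack ltac:(rewrite ?eP ?eN ?eD ?eE ?eZ ?eQ ?eR ?eV).
    by cbn; rewrite zz; lia.
  apply: exec_weaken; [apply: (@exec_pop1 _ _ _ _ (nseq k true));
    [by rewrite /st9 ed |] | | by [] |].
  - apply: exec_seq; first exact: exec_clear.
    apply: exec_seq; first exact: exec_clear.
    by apply: exec_seq; exact: exec_mv.
  - by_stack ltac:(rewrite ?eX ?catrevE ?cats0 ?revK ?eP ?eN ?eD ?eE ?eZ ?eQ ?eR ?eV).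
  - by cbn; rewrite eX catrevE cats0 !size_rev size_nseq zz; lia.
apply: exec_weaken.
- apply: exec_seq e1 (exec_seq e2 (exec_seq e3 (exec_seq e4 (exec_seq e5
   (exec_seq e6 (exec_seq e7 (exec_seq e8 (exec_seq e9 e10)))))))).
- by [].
- by [].
- rewrite /trial_cost.
  have l1 : N * (7 * d + 27) <= N * (7 * q + 27) by rewrite leq_mul //; lia.
  have l2 : N * (7 * d2 + 27) <= N * (7 * q + 27) by rewrite leq_mul //; lia.
  lia.
Qed.

(** * Reading the input and counting the trials *)

Definition read_unary (s : nat) : prog :=
  Seq (Push sF true) (While sF (Pop sA Skip (clear sF) (Push s true))).

Lemma exec_read_unary s st rs n a : s \in [:: sX; sY] ->
  st sA = nseq n true ++ false :: a -> st sF = [::] -> st s = [::] ->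
  exec (read_unary s) st rs (upd (upd st sA a) s (nseq n true)) rs (3 * n + 10).
Proof.
move=> sin eA eF es.
have H k st' : st' sF = [:: true] -> st' sA = nseq n true ++ false :: a ->
    st' s = nseq k true ->
    exec (While sF (Pop sA Skip (clear sF) (Push s true))) st' rs
      (upd (upd (upd st' sA a) s (nseq (n + k) true)) sF [::]) rs (3 * n + 8).
  elim: n k st' {eA eF es} => [|n IH] k st' eF eA es.
    apply: exec_weaken.
    - apply: exec_while; first by rewrite eF.
        by apply: exec_pop0 eA _; exact: exec_clear.
      by apply: exec_while_nil.
    - by move: sin es; rewrite !inE; case/orP=> /eqP-> es; by_stack ltac:(rewrite ?es).
    - by [].
    - by cbn; rewrite eF.
  apply: exec_weaken.
  - apply: exec_while; first by rewrite eF.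
      apply: exec_pop1; [exact: eA | exact: exec_push].
    apply: (IH k.+1).
    + by move: sin; rewrite !inE; case/orP=> /eqP->.
    + by move: sin; rewrite !inE; case/orP=> /eqP->.
    + by move: sin es; rewrite !inE; case/orP=> /eqP-> es; cbn; rewrite es.
  - by rewrite addnS; move: sin es; rewrite !inE; case/orP=> /eqP-> es; by_stack idtac.
  - by [].
  - lia.
apply: exec_weaken.
- apply: exec_seq; first exact: exec_push.
  by apply: (H 0); move: sin eF; rewrite !inE; case/orP=> /eqP es' eF; subst; cbn; rewrite ?eF.
- by rewrite addn0; move: sin; rewrite !inE; case/orP=> /eqP->; by_stack ltac:(rewrite ?eF).
- by [].
- lia.
Qed.

Definition make_mask : prog :=
  Seq (foreach sY (fun=> Seq (Pop sX Skip Skip Skip) (Push sM false)))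
    (foreach sX (fun=> Push sM true)).

Lemma exec_make_mask st rs N m : m <= N ->
  st sX = nseq N true -> st sY = nseq m true -> st sM = [::] ->
  exec make_mask st rs
    (upd (upd (upd st sX [::]) sY [::]) sM
      (nseq (N - m) true ++ nseq m false)) rs (9 * N + 9).
Proof.
move=> lm eX eY eM.
pose F i := upd (upd (upd st sX (nseq (N - i) true)) sY (nseq (m - i) true))
  sM (nseq i false).
pose G i := upd (upd (upd st sX (nseq (N - m - i) true)) sY [::])
  sM (nseq i true ++ nseq m false).
apply: exec_weaken.
- apply: exec_seq.
    have -> : st = F 0 by rewrite /F !subn0; by_stack ltac:(rewrite ?eX ?eY ?eM).
    apply: (@exec_repeat _ _ 4 m F (fun=> rs)) => // i lt.
    apply: exec_weaken.
    + apply: exec_seq; last exact: exec_push.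
      apply: (@exec_pop1 _ _ _ _ (nseq (N - i.+1) true)); last exact: exec_skip.
      by rewrite /F; cbn; rewrite -nseqS; congr nseq; lia.
    + by rewrite /F; by_stack idtac.
    + by [].
    + by [].
  have -> : F m = G 0 by rewrite /F /G subnn subn0; by_stack idtac.
  apply: (@exec_repeat _ _ 1 (N - m) G (fun=> rs)) => // i lt.
  apply: exec_weaken; [exact: exec_push | | by [] | by []].
  by rewrite /G; by_stack idtac.
- by rewrite /G subnn; by_stack idtac.
- by [].
- lia.
Qed.

Definition meet_row (h k : seq bool) : seq bool :=
  [seq p.1 && p.2 | p <- zip h k].

(** Reading reverses the masks on [sK] and [sJ]. This is the orientation wanted: the row they are
    later compared with has been reversed by [half_prog]. *)
Definition read_outputs : prog :=
  Seq (foreach sM (fun h => Seq (Push sX h)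
         (Pop sA Skip (Seq (Push sK false) (Push sJ false))
                      (Seq (Push sK true) (Push sJ h)))))
    (mv sX sM).

Lemma exec_read_outputs st rs h k a : size k = size h ->
  st sM = h -> st sA = k ++ a -> st sX = [::] -> st sK = [::] -> st sJ = [::] ->
  exec read_outputs st rs
    (upd (upd (upd st sA a) sK (rev k)) sJ (rev (meet_row h k)))
    rs (11 * size h + 10).
Proof.
move=> sz eM eA eX eK eJ.
have e1 : exec (foreach sM (fun h => Seq (Push sX h)
         (Pop sA Skip (Seq (Push sK false) (Push sJ false))
                      (Seq (Push sK true) (Push sJ h))))) st rs
    (upd (upd (upd (upd (upd st sA a) sM [::]) sX (catrev h (st sX)))
      sK (catrev k (st sK))) sJ (catrev (meet_row h k) (st sJ)))
    rs (8 * size h + 1).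
  elim: h k st sz eM eA {eX eK eJ} => [|x h IH] [|y k] st //= sz eM eA.
    apply: exec_weaken; [exact: (exec_foreach_nil _ _ eM) | | by [] | by []].
    by by_stack ltac:(rewrite ?eM ?eA).
  pose st0 := upd (upd (upd (upd (upd st sM h) sX (x :: st sX))
        sA (k ++ a)) sK (y :: st sK)) sJ ((x && y) :: st sJ).
  have e0 : exec (Seq (Push sX x)
         (Pop sA Skip (Seq (Push sK false) (Push sJ false))
                      (Seq (Push sK true) (Push sJ x))))
      (upd st sM h) rs st0 rs 6.
    rewrite /st0; case: y eA {st0} => eA; rewrite ?andbT ?andbF;
    by (apply: exec_weaken; [by ex | by_stack idtac | by [] | by []]).
  apply: exec_weaken.
  - apply: exec_foreach_cons eM e0 (IH k _ _ _ _).
    + by case: sz.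
    + by [].
    + by [].
  - by rewrite -/(meet_row h k); move: (meet_row h k) => u; by_stack idtac.
  - by [].
  - lia.
apply: exec_weaken; [apply: exec_seq e1 _; exact: exec_mv | | by [] |].
- by by_stack ltac:(rewrite ?eX ?eM ?eK ?eJ ?catrevE ?cats0 ?revK).
- by cbn; rewrite eX catrevE cats0 size_rev; lia.
Qed.

(** Multiplies the counter by N + 1: the mask [sM] has N entries, and one more mark is pushed for
    each round. *)
Definition times_prog : prog :=
  Seq (foreach sL (fun=> Seq (Push sY true)
    (Seq (foreach sM (fun h => Seq (Push sX h) (Push sY true))) (mv sX sM))))
    (mv sY sL).

Lemma exec_times st rs l :
  st sL = nseq l true -> st sX = [::] -> st sY = [::] ->
  exec times_prog st rs (upd st sL (nseq (l * (size (st sM)).+1) true)) rs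
    (l * (11 * size (st sM) + 16) + 5).
Proof.
move=> eL eX eY; set N := size (st sM).
have H st' h k : st' sM = h -> st' sY = nseq k true ->
    exec (foreach sM (fun h => Seq (Push sX h) (Push sY true))) st' rs
    (upd (upd (upd st' sM [::]) sX (catrev h (st' sX)))
      sY (nseq (size h + k) true)) rs (5 * size h + 1).
  elim: h k st' => [|x h IH] k st' eM eY'.
    apply: exec_weaken; [exact: (exec_foreach_nil _ _ eM) | | by [] | by []].
    by by_stack ltac:(rewrite ?eM ?eY').
  apply: exec_weaken.
  - apply: exec_foreach_cons eM _ (IH k.+1 _ _ _).
    + by apply: exec_seq; exact: exec_push.
    + by [].
    + by cbn; rewrite eY'.
  - by rewrite addnS; by_stack idtac.
  - by [].
  - by rewrite /=; lia.
pose F i := upd (upd st sL (nseq (l - i) true)) sY (nseq (i * N.+1) true).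
have F0 : F 0 = st by rewrite /F subn0; by_stack ltac:(rewrite ?eL ?eY).
apply: exec_weaken.
- apply: exec_seq.
    rewrite -{1}F0.
    apply: (@exec_repeat _ _ (8 * N + 6) l F (fun=> rs)) => // i lt.
    apply: exec_weaken.
    + apply: exec_seq; first exact: exec_push.
      apply: exec_seq; last exact: exec_mv.
      by apply: (H _ (st sM) (i * N.+1).+1).
    + rewrite /F (_ : i.+1 * N.+1 = N + (i * N.+1).+1) -/N; last by lia.
      by by_stack ltac:(rewrite ?eX ?catrevE ?cats0 ?revK).
    + by [].
    + by cbn; rewrite eX catrevE cats0 size_rev -/N; lia.
  exact: exec_mv.
- by rewrite /F subnn; cbn; rewrite (catrev_nseq (l * N.+1) 0) addn0; by_stack ltac:(rewrite ?eY).
- by [].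
- by rewrite /F; cbn; rewrite size_nseq; lia.
Qed.

Definition double_prog (s : nat) : prog :=
  Seq (foreach s (fun=> Seq (Push sY true) (Push sY true))) (mv sY s).

Lemma exec_double s st rs l : s \in [:: sQ; sL] ->
  st s = nseq l true -> st sY = [::] ->
  exec (double_prog s) st rs (upd st s (nseq l.*2 true)) rs (11 * l + 3).
Proof.
move=> sin es eY.
pose F i := upd (upd st s (nseq (l - i) true)) sY (nseq i.*2 true).
have F0 : F 0 = st.
  rewrite /F subn0; move: sin es; rewrite !inE.
  by case/orP=> /eqP-> es; by_stack ltac:(rewrite ?es ?eY).
apply: exec_weaken.
- apply: exec_seq.
    rewrite -{1}F0.
    apply: (@exec_repeat _ _ 3 l F (fun=> rs)) => i lt.
      by move: sin; rewrite /F !inE; case/orP=> /eqP->.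
    move: sin; rewrite /F !inE doubleS; case/orP=> /eqP->;
    by (apply: exec_weaken; [by ex | by_stack idtac | by [] | by []]).
  by apply: exec_mv; move: sin; rewrite !inE; case/orP=> /eqP->.
- move: sin es; rewrite /F subnn !inE; case/orP=> /eqP-> es; cbn;
  by rewrite (catrev_nseq l.*2 0) addn0; by_stack ltac:(rewrite ?eY).
- by [].
- by move: sin; rewrite /F !inE; case/orP=> /eqP->; cbn; rewrite size_nseq; lia.
Qed.

Definition grow_prog : prog :=
  Seq (foreach sJ (fun j => Seq (Push sX j)
    (if j then Seq (double_prog sQ) (Seq (double_prog sL) (double_prog sL))
     else Skip))) (mv sX sJ).

Lemma exec_grow st rs q l qm lm :
  st sQ = nseq q true -> st sL = nseq l true -> st sX = [::] -> st sY = [::] ->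
  q * 2 ^ ones (st sJ) <= qm -> l * 4 ^ ones (st sJ) <= lm ->
  exec grow_prog st rs
    (upd (upd st sQ (nseq (q * 2 ^ ones (st sJ)) true))
       sL (nseq (l * 4 ^ ones (st sJ)) true)) rs
    (size (st sJ) * (11 * qm + 33 * lm + 20) + 5).
Proof.
move=> eQ eL eX eY lq ll.
have e1 : exec (foreach sJ (fun j => Seq (Push sX j)
    (if j then Seq (double_prog sQ) (Seq (double_prog sL) (double_prog sL))
     else Skip))) st rs
    (upd (upd (upd (upd st sJ [::]) sX (catrev (st sJ) (st sX)))
      sQ (nseq (q * 2 ^ ones (st sJ)) true))
       sL (nseq (l * 4 ^ ones (st sJ)) true)) rs
    (size (st sJ) * (11 * qm + 33 * lm + 17) + 1).
  move ej: (st sJ) lq ll => j.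
  elim: j q l st ej eQ eL eY {eX} => [|x j IH] q l st ej eQ eL eY /=.
    move=> _ _; rewrite !expn0 !muln1.
    apply: exec_weaken; [exact: (exec_foreach_nil _ _ ej) | | by [] | by []].
    by by_stack ltac:(rewrite ?ej ?eQ ?eL).
  case: x ej => ej /=; last first.
    move=> lq ll; apply: exec_weaken.
    - apply: exec_foreach_cons ej _ (IH q l _ _ _ _ _ lq ll) => //.
      1: by apply: exec_seq; [exact: exec_push | exact: exec_skip].
      all: try by [].
    - by by_stack idtac.
    - by lia.
  rewrite add1n !expnS !mulnA -/(ones j) => lq ll.
  have [p2 p4] : 0 < 2 ^ ones j /\ 0 < 4 ^ ones j by rewrite !expn_gt0.
  have bq : q <= qm by nia.
  have bl : l * 4 <= lm by nia.
  apply: exec_weaken.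
  - apply: exec_foreach_cons ej _ (IH (q * 2) (l * 4) _ _ _ _ _ lq ll).
    + apply: exec_seq; first exact: exec_push.
      apply: exec_seq; first exact: (@exec_double sQ _ _ q).
      apply: exec_seq; first exact: (@exec_double sL _ _ l).
      exact: (@exec_double sL _ _ l.*2).
    + by [].
    + by rewrite muln2.
    + by rewrite (_ : l * 4 = l.*2.*2) //; lia.
    + by [].
  - by by_stack idtac.
  - by [].
  - by lia.
apply: exec_weaken; [apply: exec_seq e1 _; exact: exec_mv | | by [] |].
- by by_stack ltac:(rewrite ?eX ?catrevE ?cats0 ?revK).
- by cbn; rewrite eX catrevE cats0 size_rev; lia.
Qed.

(** [b] and [d] are constants, unrolled into the program text. With k the number of marks on [sJ],
    the final counters are 2^k on [sQ] and b (N + 1)^d 4^k on [sL]. *)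
Definition count_prog (b d : nat) : prog :=
  Seq (Push sQ true) (Seq (iter b (Seq (Push sL true)) Skip)
    (Seq (iter d (Seq times_prog) Skip) grow_prog)).

Lemma exec_pushes b st rs :
  exec (iter b (Seq (Push sL true)) Skip) st rs
    (upd st sL (catrev (nseq b true) (st sL))) rs (2 * b + 1).
Proof.
elim: b st => [|b IH] st /=.
  by apply: (exec_weaken (exec_skip _ _)) => //; by_stack idtac.
apply: exec_weaken.
- by apply: exec_seq; [exact: exec_push | exact: IH].
- by by_stack idtac.
- by [].
- lia.
Qed.

Lemma exec_times_pow d st rs l lm :
  st sL = nseq l true -> st sX = [::] -> st sY = [::] ->
  l * (size (st sM)).+1 ^ d <= lm ->
  exec (iter d (Seq times_prog) Skip) st rs
    (upd st sL (nseq (l * (size (st sM)).+1 ^ d) true)) rs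
    (d * (lm * (11 * size (st sM) + 16) + 7) + 1).
Proof.
elim: d l st => [|d IH] l st eL eX eY.
  move=> _; rewrite muln1.
  by apply: (exec_weaken (exec_skip _ _)) => //; by_stack ltac:(rewrite ?eL).
rewrite expnS mulnA => lb /=.
have p : 0 < (size (st sM)).+1 ^ d by rewrite expn_gt0.
have l1 : l <= lm by nia.
apply: exec_weaken.
- apply: exec_seq; first exact: exec_times eL eX eY.
  exact: (IH (l * (size (st sM)).+1)).
- by by_stack idtac.
- by [].
- set N := size _; cbn; rewrite -/N.
  have : l * (11 * N + 16) <= lm * (11 * N + 16) by rewrite leq_mul.
  by lia.
Qed.

(** * Writing the output *)

Definition emit (h y : bool) : prog := if h then Push sO y else Skip.

Definition finalize_prog : prog :=
  foreach sK (fun h => Pop sV Skip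
    (Pop sS (emit h false) (emit h false) (emit h true))
    (Pop sS (emit h true) (emit h true) (emit h true))).

(** In use, [v] vanishes on the marked wires and [s] off them, so the disjunction glues them
    together. An empty [s], when no trial has accepted, counts as zeros. *)
Fixpoint merge_row (v s : seq bool) : seq bool :=
  match v, s with
  | y :: v', x :: s' => (y || x) :: merge_row v' s'
  | _, _ => v
  end.

Lemma exec_finalize st rs k v s : size k = size v ->
  st sK = k -> st sV = v -> st sS = s -> size s <= size v ->
  exists2 st', st' sO = catrev (mask k (merge_row v s)) (st sO) &
    exec finalize_prog st rs st' rs (5 * size v + 1).
Proof.
elim: k v s st => [|x k IH] [|y v] s st //= sz eK eV eS ls.
  by exists st; first by []; exact: exec_foreach_nil.
pose o := y || head false s.
pose st0 := upd (upd (upd (upd st sK k) sV v) sS (behead s)) sO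
  (if x then o :: st sO else st sO).
have e0 : exec (Pop sV Skip
    (Pop sS (emit x false) (emit x false) (emit x true))
    (Pop sS (emit x true) (emit x true) (emit x true))) (upd st sK k) rs st0 rs 3.
  rewrite /st0 /o; case: s eS {ls st0 o} => [|z s] eS;
  case: y eV => eV; rewrite /emit; case: (x) => /=; try (case: z eS => eS);
  by (apply: exec_weaken; [by ex | by_stack ltac:(rewrite ?eS ?eV) | by [] | by []]).
have [|//|//|//||st' eO e1] := IH v (behead s) st0.
- by case: sz.
- by case: s ls {eS st0 e0 o}.
exists st'.
  rewrite {}eO /st0; cbn; rewrite /o; case: s {eS ls st0 e0 e1 o} => [|z s] /=.
    by rewrite orbF (_ : merge_row v [::] = v); [case: (x) | case: (v)].
  by case: (x).
apply: exec_weaken; [exact: exec_foreach_cons eK e0 e1 | by [] | by [] | lia].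
Qed.

Definition main_prog (b d : nat) : prog :=
  Seq (read_unary sX) (Seq (read_unary sY) (Seq make_mask (Seq read_outputs
  (Seq (toss_row sM sV) (Seq half_prog (Seq mask0_prog (Seq (count_prog b d)
  (Seq (foreach sL (fun=> trial_prog)) finalize_prog)))))))).

(** A block of 3k coins: the candidate, then the two rounds of randomized halving. A later success
    overwrites an earlier one. *)
Definition trial (f : seq bool -> nat) (j s cs : seq bool) : seq bool :=
  let k := ones j in
  let z := fill j (take k cs) in
  if accept (f z) (take k (drop k cs)) (drop (2 * k) cs) then z else s.

Fixpoint trials (f : seq bool -> nat) (j : seq bool) (n : nat)
    (cs : seq bool) : seq bool :=
  if n is n'.+1 then
    trial f j (trials f j n' cs)
      (take (3 * ones j) (drop (n' * (3 * ones j)) cs))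
  else [::].

Lemma size_trials f j n cs : size (trials f j n cs) <= size j.
Proof. by elim: n => //= n IH; rewrite /trial; case: ifP; rewrite ?size_fill. Qed.

Definition main_cost (b d N G q L : nat) :=
  half_cost N G + 2 * b + d * (L * (11 * N + 16) + 7) +
  N * (11 * q + 33 * L + 20) + L * (trial_cost N G q + 2) + 70 * N + 150.

Lemma exec_trials N st rs gs h j v q n cs :
  well_sized N gs -> all target_free_row gs ->
  size h = N -> size j = N -> size v = N ->
  iter q (inc true j) v = v -> ready st gs h j v q ->
  st sL = nseq n true -> st sS = [::] -> size cs = n * (3 * ones j) ->
  exec (foreach sL (fun=> trial_prog)) st (cs ++ rs)
    (upd (upd st sL [::]) sS (trials (net gs h j v q) j n cs)) rs
    (n * (trial_cost N (size gs) q + 2) + 1).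
Proof.
move=> ws fr zh zj zv cyc rd eL eS zcs; set f := net gs h j v q.
pose F i := upd (upd st sL (nseq (n - i) true)) sS (trials f j i cs).
have e : exec (foreach sL (fun=> trial_prog)) (F 0) (drop 0 cs ++ rs)
    (F n) (drop (n * (3 * ones j)) cs ++ rs)
    (n * (trial_cost N (size gs) q + 2) + 1).
  apply: (@exec_repeat _ _ (trial_cost N (size gs) q) n F
    (fun i => drop (i * (3 * ones j)) cs ++ rs)) => // i lt.
  set ds := drop (i * (3 * ones j)) cs.
  have zds : 3 * ones j <= size ds.
    by rewrite size_drop zcs -mulnBl leq_pmull // subn_gt0.
  set es := take (3 * ones j) ds.
  have zes : size es = 3 * ones j by rewrite size_take_min; lia.
  have tape : ds = take (ones j) es ++ take (ones j) (drop (ones j) es) ++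
      drop (2 * ones j) es ++ drop (i.+1 * (3 * ones j)) cs.
    rewrite -[in LHS](cat_take_drop (3 * ones j) ds) -/es.
    rewrite /ds drop_drop -mulSn.
    rewrite -[in LHS](cat_take_drop (ones j) es) -!catA; congr cat.
    rewrite -[in LHS](cat_take_drop (ones j) (drop _ es)) -!catA; congr cat.
    by rewrite drop_drop mul2n addnn.
  rewrite tape -!catA.
  have zs : size (trials f j i cs) <= N by rewrite -zj size_trials.
  have := @exec_trial N (upd (F i) sL (nseq (n - i.+1) true))
    (drop (i.+1 * (3 * ones j)) cs ++ rs) gs h j v q (take (ones j) es)
    (take (ones j) (drop (ones j) es)) (drop (2 * ones j) es) ws fr zh zj zv
    zs cyc rd.
  rewrite size_take_min zes size_take_min !size_drop zes => e.
  apply: exec_weaken; [apply: e; lia | | by [] | by []].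
  rewrite [F i.+1]/F -[trials f j i.+1 cs]/(trial f j (trials f j i cs) es).
  rewrite /trial -/f.
  rewrite [upd (F i) _ _ sS]/(trials f j i cs).
  move: (if _ then _ else _) => u.
  by rewrite /F; move: (trials f j i cs) => t; by_stack idtac.
have F0 : F 0 = st by rewrite /F subn0 /= -eS -eL !upd_id.
by rewrite F0 drop0 drop_oversize ?zcs // cat0s /F subnn in e.
Qed.

Definition hadamard_row N m : seq bool := nseq (N - m) true ++ nseq m false.

Lemma size_hadamard_row N m : m <= N -> size (hadamard_row N m) = N.
Proof. by move=> lm; rewrite size_cat !size_nseq subnK. Qed.

Lemma ones_hadamard_row N m : ones (hadamard_row N m) = N - m.
Proof. by rewrite /ones count_cat !count_nseq mul1n mul0n addn0. Qed.

Lemma size_mask0 j v : size j = size v -> size (mask0 j v) = size v.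
Proof. by move=> e; rewrite size_map size_zip e minnn. Qed.

Definition net_signs (gs : seq row_gate) (h j v : seq bool) : seq bool -> nat :=
  net (rev_gates gs) h j v (2 ^ ones j).

Lemma target_free_rev N gs : well_sized N gs ->
  all target_free_row gs -> all target_free_row (rev_gates gs).
Proof.
rewrite all_rev all_map; elim: gs => //= g gs IH.
case/andP=> /and3P[_ /eqP s1 /eqP s2] ws /andP[fg /(IH ws) ->].
by rewrite andbT /target_free_row /= -rev_zip ?has_rev // s1 s2.
Qed.

(** The output as a function of the coins: [xs] fixes the classical input and [cs] the trials. The
    outer [rev] returns to the increasing order of the wires. *)
Definition result (N m : nat) (gs : seq row_gate) (k : seq bool) (L : nat)
    (xs cs : seq bool) : seq bool :=
  let h := hadamard_row N m in
  let j := rev (meet_row h k) in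
  let v := mask0 j (rev (row_acts gs (fill h xs))) in
  rev (mask (rev k) (merge_row v (trials (net_signs gs h j v) j L cs))).

Lemma exec_main b d N m gs k xs cs rs :
  let h := hadamard_row N m in
  let j := rev (meet_row h k) in
  let q := 2 ^ ones j in
  let L := b * N.+1 ^ d * 4 ^ ones j in
  m <= N -> size k = N -> well_sized N gs -> all target_free_row gs ->
  (forall w, size w = N -> iter q (inc true j) (mask0 j w) = mask0 j w) ->
  size xs = N - m -> size cs = L * (3 * ones j) ->
  exists2 st', st' sO = result N m gs k L xs cs &
  exec (main_prog b d)
    (upd (fun=> [::]) 0 (nseq N true ++ false :: nseq m true ++ false ::
       k ++ stream gs)) (xs ++ cs ++ rs) st' rs
    (main_cost b d N (size gs) q L).
Proof.
move=> h j q L lm zk ws fr cyc zxs zcs.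
have zh : size h = N by exact: size_hadamard_row.
have zj : size j = N by rewrite size_rev size_map size_zip zh zk minnn.
set a0 := k ++ stream gs; set a1 := nseq m true ++ false :: a0.
set st0 := upd _ 0 _; set t0 := xs ++ cs ++ rs.
have e1 := @exec_read_unary sX st0 t0 N a1 isT erefl erefl erefl.
set st1 := upd _ sX _ in e1.
have e2 := @exec_read_unary sY st1 t0 m a0 isT erefl erefl erefl.
set st2 := upd _ sY _ in e2.
have e3 := @exec_make_mask st2 t0 N m lm erefl erefl erefl.
rewrite -/(hadamard_row N m) -/h in e3; set st3 := upd _ sM _ in e3.
have e4 := @exec_read_outputs st3 t0 h k (stream gs) (etrans zk (esym zh))
  erefl erefl erefl erefl erefl.
rewrite -/j zh in e4; set st4 := upd _ sJ _ in e4.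
have zx1 : size xs = ones (st4 sM) by rewrite [st4 sM]/= ones_hadamard_row.
have e5 := @exec_toss_row sM sV st4 (cs ++ rs) xs erefl erefl erefl zx1.
rewrite [st4 sM]/= zh in e5; set x := fill h xs in e5.
have zx : size x = N by rewrite size_fill.
set st5 := upd _ sV _ in e5.
have e6 := @exec_half N st5 (cs ++ rs) gs ws erefl erefl zx.
rewrite [st5 sV]/= in e6; set w := rev _ in e6.
have zw : size w = N by rewrite size_rev (size_row_acts ws).
set st6 := upd _ sV _ in e6.
have e7 := @exec_mask0 st6 (cs ++ rs) N zj zw erefl.
rewrite [st6 sJ]/= [st6 sV]/= in e7; set v := mask0 j w in e7.
have zv : size v = N by rewrite size_mask0 ?zj.
set st7 := upd _ sV _ in e7.
have e8 := exec_push sQ true st7 (cs ++ rs).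
rewrite [st7 sQ]/= in e8; set st8 := upd _ sQ _ in e8.
have e9 := exec_pushes b st8 (cs ++ rs).
rewrite [st8 sL]/= (catrev_nseq b 0) addn0 in e9; set st9 := upd _ sL _ in e9.
have p4 : 0 < 4 ^ ones j by rewrite expn_gt0.
have e10 := @exec_times_pow d st9 (cs ++ rs) b L erefl erefl erefl.
rewrite [st9 sM]/= zh in e10.
set l := b * N.+1 ^ d in L zcs e10 *; set st10 := upd _ sL _ in e10.
have e11 := @exec_grow st10 (cs ++ rs) 1 l q L erefl erefl erefl erefl.
rewrite [st10 sJ]/= zj mul1n -/q -/L in e11; set st11 := upd _ sL _ in e11.
(* The first [half_prog] has left the reversed circuit on [sA], so every visit begins by running the
   circuit backwards. *)
have e12 := @exec_trials N st11 rs (rev_gates gs) h j v q L cs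
  (well_sized_rev ws) (target_free_rev ws fr) zh zj zv (cyc w zw).
rewrite size_rev_gates in e12.
have {}e12 := e12 (conj (And5 erefl erefl erefl erefl erefl)
  (conj (And3 erefl erefl erefl) (And4 erefl erefl erefl erefl))) erefl erefl zcs.
rewrite -/(net_signs gs h j v) in e12.
set st12 := upd _ sS _ in e12.
have zK : size (rev k) = size v by rewrite size_rev zk zv.
have [|st' eO e13] := @exec_finalize st12 rs (rev k) v _ zK erefl erefl erefl.
  by rewrite [st12 sS]/= zv -zj size_trials.
exists st'; first by rewrite eO catrevE cats0.
apply: exec_weaken.
- apply: exec_seq e1 (exec_seq e2 (exec_seq e3 (exec_seq e4 (exec_seq e5
    (exec_seq e6 (exec_seq e7 (exec_seq (exec_seq e8 (exec_seq e9
      (exec_seq (e10 _) (e11 _ _)))) (exec_seq e12 e13)))))))) => //.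
  by rewrite /L; nia.
- by [].
- by [].
- by rewrite /main_cost; lia.
Qed.

(** * Sums over rows of bits *)

Local Open Scope ring_scope.

(** Coin tapes as plain lists rather than tuples, so that sums split along concatenation without
    casts. *)
Fixpoint rows (n : nat) : seq (seq bool) :=
  if n is n'.+1 then map (cons false) (rows n') ++ map (cons true) (rows n')
  else [:: [::]].

Lemma mem_rows n u : (u \in rows n) = (size u == n).
Proof.
elim: n u => [|n IH] [|b u] //=; rewrite mem_cat.
  by rewrite !(introF mapP) // => -[].
have inj c : injective (cons c : seq bool -> seq bool) by move=> x y [].
have ne c c' : c != c' -> (c :: u \in [seq c' :: i | i <- rows n]) = false.
  by move=> cc'; apply/negbTE/mapP => -[x _ [e _]]; rewrite e eqxx in cc'.
by case: b; rewrite mem_map // IH eqSS ne // orbF.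
Qed.

Lemma uniq_rows n : uniq (rows n).
Proof.
elim: n => //= n IH; rewrite cat_uniq !map_inj_uniq ?IH; try by move=> x y [].
by rewrite /= andbT; apply/hasPn => _ /mapP[x _ ->]; apply/mapP => -[].
Qed.

Lemma size_rows n : size (rows n) = (2 ^ n)%N.
Proof. by elim: n => //= n IH; rewrite size_cat !size_map IH addnn -mul2n expnS. Qed.

Lemma big_rows0 (V : nmodType) (F : seq bool -> V) :
  \sum_(u <- rows 0) F u = F [::].
Proof. by rewrite big_seq1. Qed.

Lemma big_rowsS (V : nmodType) n (F : seq bool -> V) :
  \sum_(u <- rows n.+1) F u =
  \sum_(u <- rows n) F (false :: u) + \sum_(u <- rows n) F (true :: u).
Proof. by rewrite big_cat !big_map. Qed.

Lemma big_rowsD (V : nmodType) m n (F : seq bool -> V) :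
  \sum_(u <- rows (m + n)) F u =
  \sum_(u <- rows m) \sum_(v <- rows n) F (u ++ v).
Proof.
by elim: m F => [|m IH] F; rewrite ?big_rows0 // addSn !big_rowsS !IH.
Qed.

Lemma big_rows_fin (V : nmodType) (T : finType) n (phi : T -> seq bool)
    (F : seq bool -> V) :
  injective phi -> (forall x, size (phi x) = n) ->
  (forall u, size u = n -> exists x, phi x = u) ->
  \sum_(x : T) F (phi x) = \sum_(u <- rows n) F u.
Proof.
move=> inj zphi sur.
rewrite -(big_map phi xpredT F) /=; apply: perm_big; apply: uniq_perm.
- by rewrite map_inj_uniq // index_enum_uniq.
- exact: uniq_rows.
move=> u; rewrite mem_rows; apply/mapP/eqP => [[x _ ->] //|/sur[x <-]].
by exists x; rewrite // mem_index_enum.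
Qed.

Lemma big_rows_tuple (V : nmodType) n (F : seq bool -> V) :
  \sum_(t : n.-tuple bool) F t = \sum_(u <- rows n) F u.
Proof.
apply: big_rows_fin => [|x|u e]; first exact: val_inj.
  by rewrite size_tuple.
by exists (tcast e (in_tuple u)); rewrite val_tcast.
Qed.

Lemma big_rows_const (V : nmodType) n (a : V) :
  \sum_(u <- rows n) a = a *+ 2 ^ n.
Proof. by rewrite big_const_seq count_predT size_rows iter_addr_0. Qed.

Lemma ones_cons b j : ones (b :: j) = (b + ones j)%N.
Proof. by case: b. Qed.

(** [fill h] is a bijection from strings of length [ones h] to the rows supported on [h]. *)
Lemma big_fill (V : nmodType) h (F : seq bool -> V) :
  \sum_(c <- rows (ones h)) F (fill h c) =
  \sum_(u <- rows (size h)) if allowed h u then F u else 0.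
Proof.
elim: h F => [|x h IH] F; first by rewrite !big_rows0.
rewrite [size _]/= big_rowsS; case: x; rewrite /= ?add1n ?add0n -/(ones h).
  by rewrite big_rowsS /= (IH (fun u => F (false :: u))) (IH (fun u => F (true :: u))).
rewrite (IH (fun u => F (false :: u))) [X in _ = _ + X]big1 ?addr0 //.
Qed.

(** Masking forgets the unmarked bits, so each row supported on [h] is hit once for every choice of
    them. *)
Lemma big_meet (V : nmodType) h (F : seq bool -> V) :
  \sum_(u <- rows (size h)) F (meet_row h u) =
  (\sum_(c <- rows (ones h)) F (fill h c)) *+ 2 ^ (size h - ones h).
Proof.
elim: h F => [|x h IH] F; first by rewrite !big_rows0.
have le : (ones h <= size h)%N by exact: count_size.
rewrite [size _]/= big_rowsS; case: x; rewrite /= ?add1n ?add0n -/(ones h).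
  rewrite subSS big_rowsS mulrnDl /=.
  by rewrite (IH (fun u => F (false :: u))) (IH (fun u => F (true :: u))).
rewrite (IH (fun u => F (false :: u))) subSn // expnS mul2n -addnn mulrnDr //.
Qed.

Lemma iter_inc_false i j y v :
  iter i (inc true (false :: j)) (y :: v) = y :: iter i (inc true j) v.
Proof. by elim: i => //= i ->. Qed.

Lemma inc_false j v : size j = size v -> inc false j v = v.
Proof.
by elim: j v => [|x j IH] [|y v] //= [e]; rewrite andbF addbF !IH //; case: x.
Qed.

Lemma size_iter_inc i j v :
  size j = size v -> size (iter i (inc true j) v) = size v.
Proof. by move=> e; elim: i => //= i IH; rewrite size_inc IH. Qed.

(** The low marked bit alternates, and every second increment carries into the rest. *)
Lemma iter_inc_true i (b : bool) j v : size j = size v ->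
  iter (b + i.*2) (inc true (true :: j)) (false :: v) = b :: iter i (inc true j) v.
Proof.
move=> e; have e2 k : iter k.*2 (inc true (true :: j)) (false :: v) =
    false :: iter k (inc true j) v.
  by elim: k => //= k ->; rewrite /= inc_false // size_iter_inc.
by case: b; rewrite ?add0n // add1n iterS e2 /= inc_false // size_iter_inc.
Qed.

Lemma iter_inc_cycle j w : size j = size w ->
  iter (2 ^ ones j) (inc true j) (mask0 j w) = mask0 j w.
Proof.
elim: j w => [|x j IH] [|y w] //= [e].
rewrite /mask0 /= -/(mask0 j w); case: x => /=.
  have := @iter_inc_true (2 ^ ones j) false j (mask0 j w).
  rewrite andbF add0n add1n expnS mul2n => -> //; rewrite ?size_mask0 ?IH //.
by rewrite add0n iter_inc_false IH // andbT.
Qed.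

(** One period of the counter meets every row that agrees with [w] off [j] exactly once. *)
Lemma big_inc (V : nmodType) j w (F : seq bool -> V) : size j = size w ->
  \sum_(i < 2 ^ ones j) F (iter i (inc true j) (mask0 j w)) =
  \sum_(u <- rows (size j)) if mask0 j u == mask0 j w then F u else 0.
Proof.
elim: j w F => [|x j IH] [|y w] F // ze.
  by rewrite big_rows0 big_ord1.
case: ze => e; rewrite ones_cons [size _]/= [mask0 _ (y :: w)]/mask0 /= -/(mask0 j w).
case: x; rewrite ?andbF ?andbT ?add0n ?add1n; last first.
  under eq_bigr do rewrite iter_inc_false.
  rewrite (IH w (fun u => F (y :: u)) e) big_rowsS.
  by case: y; [rewrite [X in _ = X + _]big1 ?add0r
              |rewrite [X in _ = _ + X]big1 ?addr0].
rewrite expnS mul2n -addnn big_rowsS.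
rewrite -(IH w (fun u => F (false :: u)) e) -(IH w (fun u => F (true :: u)) e).
rewrite -(big_mkord xpredT (fun i => F (iter i (inc true (true :: j)) _))).
rewrite -!(big_mkord xpredT (fun i => F (_ :: iter i _ _))).
have ze : size j = size (mask0 j w) by rewrite size_mask0.
(* Generalized to q + q increments: times 2i and 2i + 1 show the low bits 0 and 1 in front of the
   i-th value of the rest. *)
elim: (2 ^ ones j)%N => [|q IHq]; first by rewrite !big_nil addr0.
have e0 := iter_inc_true q false ze; rewrite add0n -addnn in e0.
have e1 := iter_inc_true q true ze; rewrite add1n -addnn in e1.
by rewrite addSn addnS !big_nat_recr // e0 e1 IHq addrACA addrA.
Qed.

(** The first coin leads to the floor or the ceiling of d / 2, whose sum is d. The bound d <= 2^k is
    inherited and ends as d <= 1, where positivity is the value itself. *)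
Lemma sum_randomized_halving k d : (d <= 2 ^ k)%N ->
  (\sum_(cs <- rows k) (0 < randomized_halving d cs))%N = d.
Proof.
elim: k d => [|k IH] d ld.
  by rewrite big_seq1 /=; case: d ld => [|[|]].
rewrite [rows _]/= big_cat !big_map /= addn0 !IH.
- by rewrite addn1 -uphalfE addnC uphalf_half -addnA addnn odd_double_half.
- by rewrite expnS in ld; rewrite addn1 -uphalfE leq_uphalf_double -mul2n.
- by rewrite expnS in ld; rewrite leq_half_double -mul2n; lia.
Qed.

(** The second block succeeds for d of its tapes, but only after a success of the first block. *)
Lemma sum_accept k d : (d <= 2 ^ k)%N ->
  (\sum_(cs <- rows k) \sum_(cs' <- rows k) accept d cs cs')%N = (d * d)%N.
Proof.
move=> ld; rewrite -[X in (d * X)%N](sum_randomized_halving ld) big_distrr /=.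
apply: eq_bigr => cs _; rewrite /accept sum_randomized_halving; last by case: ifP.
by case: (randomized_halving d cs) => [|n] /=; lia.
Qed.

(** * Output distribution of the trials *)

(** The difference of the two counters is the signed sum; since one of them is 0, their sum equals
    it up to a sign, which the square removes. *)
Lemma net_sqr (R : comNzRingType) gs h j v q z :
  (net gs h j v q z)%:R ^+ 2 =
  (\sum_(i < q) let u := iter i (inc true j) v in
     if valid gs h u then (-1) ^+ parity z u else 0 : R) ^+ 2.
Proof.
set s := \sum_(i < q) _.
suff [e z0] : let pn := (iter q (visit gs h j z) (v, (0, 0)%N)).2 in
    pn.1%:R - pn.2%:R = s /\ (pn.1 = 0%N \/ pn.2 = 0%N).
  rewrite -e /net natrD; case: z0 => ->; rewrite ?add0r ?addr0 ?sub0r ?subr0 //.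
  by rewrite sqrrN.
rewrite {}/s /=; elim: q => [|q [IH z0]]; first by rewrite big_ord0 subrr; auto.
rewrite big_ord_recr /= -IH iter_visit.
case: (iter q (visit gs h j z) _).2 z0 => p n /= z0.
rewrite /signed_tally; case: ifP => _; last by rewrite addr0.
case: (parity _ _) => /=.
  case: p z0 => [|p] z0 /=; rewrite ?mulrS; (split; first by ring); first by left.
  by case: z0; [|right].
case: n z0 => [|n] z0 /=; rewrite ?mulrS; (split; first by ring); first by right.
by case: z0; [left|].
Qed.

Section Trials.
Variables (R : realFieldType) (f : seq bool -> nat) (j : seq bool).
Hypothesis f_le : forall z, (f z <= 2 ^ ones j)%N.
Local Notation k := (ones j).

(** The total of [G] over the accepting blocks of 3k coins; [weight G / weight (fun=> 1)] is thus
    the expectation given acceptance. *)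
Definition weight (G : seq bool -> R) : R :=
  \sum_(c <- rows k) (f (fill j c))%:R ^+ 2 * G (fill j c).

(** For each candidate, the square of its count is the number of accepting continuations among 4^k;
    all other blocks keep [s]. *)
Lemma sum_trial s G :
  \sum_(cs <- rows (3 * k)) G (trial f j s cs) =
  weight G + (2 ^+ (3 * k) - weight (fun=> 1)) * G s.
Proof.
have e2 n : \sum_(u <- rows n) (1 : R) = 2 ^+ n.
  by rewrite big_rows_const natrX.
transitivity (\sum_(c <- rows k) \sum_(c2 <- rows k) \sum_(c3 <- rows k)
    (G s + (accept (f (fill j c)) c2 c3)%:R * (G (fill j c) - G s))).
  rewrite (_ : 3 * k = k + (k + k))%N; last by lia.
  rewrite big_rowsD big_seq [RHS]big_seq; apply: eq_bigr => c.
  rewrite mem_rows => /eqP zc; rewrite big_rowsD.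
  rewrite big_seq [RHS]big_seq; apply: eq_bigr => c2.
  rewrite mem_rows => /eqP zc2; apply: eq_bigr => c3 _.
  rewrite /trial take_size_cat // drop_size_cat // take_size_cat //.
  rewrite mul2n -addnn -drop_drop drop_size_cat // drop_size_cat //.
  by case: ifP => _; rewrite /= ?mul1r ?mul0r ?addr0 // addrC subrK.
transitivity (\sum_(c <- rows k)
   (2 ^+ (2 * k) * G s + (f (fill j c))%:R ^+ 2 * (G (fill j c) - G s))).
  apply: eq_bigr => c _.
  under eq_bigr do rewrite big_split /= -mulr_suml.
  rewrite big_split /= -mulr_suml; congr (_ + _ * _).
    rewrite !big_rows_const -mulrnA -expnD addnn -mul2n.
    by rewrite -[LHS]mulr_natl natrX.
  rewrite -natrX -mulnn -(sum_accept (f_le _)).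
  rewrite natr_sum; apply: eq_bigr => c2 _; rewrite natr_sum.
  by [].
rewrite big_split /= big_rows_const.
under eq_bigr do rewrite mulrBr.
have -> : weight (fun=> 1) = \sum_(c <- rows k) (f (fill j c))%:R ^+ 2.
  by apply: eq_bigr => c _; rewrite mulr1.
rewrite sumrB -mulr_suml /weight.
rewrite -[_ *+ _]mulr_natl natrX.
rewrite (_ : 3 * k = k + 2 * k)%N; last by lia.
rewrite exprD; ring.
Qed.

Lemma trials_cat n cs es : size cs = (n * (3 * k))%N ->
  trials f j n (cs ++ es) = trials f j n cs.
Proof.
move=> zc; have : (n * (3 * k) <= size cs)%N by rewrite zc.
elim: n {zc} => //= n IH; rewrite mulSn => le.
rewrite IH ?drop_cat; last by lia.
(* The remaining case means that a trial reads no coin at all. *)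
case: ltnP => lt; last first.
  have k0 : (3 * k = 0)%N by lia.
  by rewrite k0 !take0.
rewrite take_cat size_drop; case: ltnP => // le2.
by rewrite (_ : _ - _ = 0)%N ?take0 ?cats0 ?take_oversize ?size_drop //; lia.
Qed.

(** Trials are independent with one conditional law, so the last accepted candidate has that law
    too; [p] is the probability that all of them reject. *)
Lemma sum_trials n G : weight (fun=> 1) != 0 ->
  \sum_(cs <- rows (n * (3 * k))) G (trials f j n cs) =
  2 ^+ (n * (3 * k)) *
  (let p := (1 - weight (fun=> 1) / 2 ^+ (3 * k)) ^+ n in
   (1 - p) * (weight G / weight (fun=> 1)) + p * G [::]).
Proof.
move=> w0; elim: n => [|n IH] /=.
  by rewrite mul0n big_rows0 /= !expr0 subrr mul0r add0r !mul1r.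
rewrite mulSn addnC big_rowsD.
transitivity (\sum_(cs <- rows (n * (3 * k)))
  (weight G + (2 ^+ (3 * k) - weight (fun=> 1)) * G (trials f j n cs))).
  rewrite big_seq [RHS]big_seq; apply: eq_bigr => cs; rewrite mem_rows => /eqP zc.
  rewrite -sum_trial big_seq [RHS]big_seq; apply: eq_bigr => es.
  rewrite mem_rows => /eqP ze /=.
  by rewrite trials_cat // drop_size_cat // take_oversize // ze.
rewrite big_split /= -mulr_sumr IH /= big_rows_const -[weight G *+ _]mulr_natl natrX.
rewrite exprD exprS.
set p := (1 - _) ^+ n; set B := 2 ^+ (3 * k); set w := weight (fun=> 1).
have B0 : B != 0 by rewrite expf_neq0 // pnatr_eq0.
by field; apply/andP.
Qed.

End Trials.

(** * The Hadamard-classical state *)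

Section ClassAverage.
Variables (R : realFieldType) (T : finType) (S : eqType) (key : T -> S).
Variable (P : pred T).

Definition class_sum (g : T -> R) (x : T) : R :=
  \sum_(x' | P x' && (key x' == key x)) g x'.

Lemma class_sum_key g x x' : key x = key x' -> class_sum g x = class_sum g x'.
Proof. by rewrite /class_sum => ->. Qed.

Lemma class_size_gt0 x : P x -> 0 < class_sum (fun=> 1) x.
Proof.
move=> Px; rewrite /class_sum (bigD1 x) ?Px ?eqxx //= ltr_pwDl ?ltr01 //.
by apply: sumr_ge0.
Qed.

(** [G] and the class sums are constant on classes, so [g] may be replaced by its mean over the
    class. This turns a coherent sum over pairs of inputs with the same key into an average over one
    classical input. *)
Lemma class_average (G g : T -> R) :
  (forall x x', key x = key x' -> G x = G x') ->
  \sum_(x | P x) G x * g x * class_sum g x =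
  \sum_(x | P x) G x * class_sum g x ^+ 2 / class_sum (fun=> 1) x.
Proof.
move=> Gk; apply/esym.
transitivity (\sum_(x | P x) \sum_(x' | P x' && (key x' == key x))
   G x * class_sum g x / class_sum (fun=> 1) x * g x').
  by apply: eq_bigr => x _; rewrite -mulr_sumr -/(class_sum g x); ring.
rewrite (exchange_big_dep P) /=; last by move=> x x' _ /andP[].
apply: eq_bigr => x' Px'.
transitivity (\sum_(x | P x && (key x == key x'))
   G x' * class_sum g x' / class_sum (fun=> 1) x' * g x' * 1).
  apply: eq_big => [x|x /andP[_ /andP[_ /eqP e]]]; first by rewrite Px' eq_sym.
  by rewrite mulr1 (Gk x x') // (class_sum_key _ (esym e)) (class_sum_key _ (esym e)).
rewrite -mulr_sumr -/(class_sum (fun=> 1) x').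
by have := class_size_gt0 Px'; move=> /lt0r_neq0 c0; field.
Qed.

End ClassAverage.

Section Amplitudes.
Variables (R : realType) (N m : nat) (C : circuit N) (K : {set 'I_N}).
Hypothesis le_mN : (m <= N)%N.

Local Notation s2 := ((Num.sqrt 2)^-1 : R).
Local Notation n := (N - m)%N.

Lemma s2_sqr : s2 ^+ 2 = 2^-1.
Proof. by rewrite exprVn sqr_sqrtr. Qed.

Definition hadamard_re (a b : bool) : R := (-1) ^+ (a && b) * s2.

Definition layer_re (y w : bits N) : R :=
  \prod_(i < N)
    (if (i < n)%N then hadamard_re (y i) (w i) else (y i == w i)%:R).

Lemma hadamard_layerE y w :
  hadamard_layer R m y w = real_complex R (layer_re y w).
Proof.
rewrite /hadamard_layer /tensor rmorph_prod; apply: eq_bigr => i _ /=.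
case: ifP => _; last by rewrite /identity1 rmorph_nat.
by rewrite /hadamard /hadamard_re rmorphM /= rmorphXn rmorphN1.
Qed.

Definition start : pred (bits N) :=
  fun x => [forall i : 'I_N, (n <= i)%N ==> ~~ x i].

Lemma card_hadamard (a : R) :
  \prod_(i < N) (if (i < n)%N then a else 1) = a ^+ n.
Proof.
rewrite -big_mkcond /= -(big_ord_widen N (fun=> a)) ?leq_subr //.
by rewrite prodr_const card_ord.
Qed.

Lemma layer_re0 x : layer_re x [ffun=> false] = (start x)%:R * s2 ^+ n.
Proof.
rewrite -card_hadamard /start; case: (boolP [forall i, _]) => /= [/forallP x0|].
  rewrite mul1r; apply: eq_bigr => i _; rewrite ffunE.
  have := x0 i; rewrite /hadamard_re andbF expr0 mul1r.
  by case: ltnP => //= _ /negbTE ->.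
move=> h; case/forallPn: h => i; rewrite mul0r.
rewrite negb_imply negbK => /andP[ni xi].
by rewrite /layer_re (bigD1 i) //= ltnNge ni /= xi ffunE mul0r.
Qed.

Lemma hcmq_stateE y : hcmq_state R m C y =
  real_complex R (\sum_(x | start x) layer_re y (circuit_act C x) * s2 ^+ n).
Proof.
rewrite /hcmq_state ffunE rmorph_sum.
under eq_bigr do rewrite ffunE mulr_sumr.
rewrite exchange_big [RHS]big_mkcond; apply: eq_bigr => x _ /=.
rewrite (bigD1 (circuit_act C x)) //= big1 ?addr0; last first.
  by move=> w /negbTE e; rewrite /perm_op e mul0r mulr0.
rewrite /perm_op eqxx mul1r ffunE (bigD1 [ffun=> false]) //= big1 ?addr0; last first.
  by move=> w /negbTE e; rewrite ffunE e mulr0.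
rewrite ffunE eqxx mulr1 !hadamard_layerE layer_re0 -rmorphM.
by case: ifP => _; rewrite ?mul1r // mul0r mulr0.
Qed.

(** The amplitudes are real, so the square is a double sum over inputs; the first layer contributes
    the factor 2^-n. *)
Lemma hcmq_probE (z : #|K|.-tuple bool) :
  hcmq_prob R m C z = 2^-1 ^+ n *
  \sum_(x | start x) \sum_(x' | start x')
    \sum_(y : bits N | outcome K y == z)
       layer_re y (circuit_act C x) * layer_re y (circuit_act C x').
Proof.
rewrite /hcmq_prob.
transitivity (\sum_(y : bits N | outcome K y == z) 2^-1 ^+ n *
   \sum_(x | start x) \sum_(x' | start x')
     layer_re y (circuit_act C x) * layer_re y (circuit_act C x')).
  apply: eq_bigr => y _; rewrite hcmq_stateE /= expr0n /= addr0 sqr_sqrtr ?sqr_ge0 //.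
  rewrite -mulr_suml exprMn mulrC -exprM mulnC exprM s2_sqr; congr (_ * _).
  by rewrite expr2 mulr_suml; apply: eq_bigr => x _; rewrite mulr_sumr.
rewrite -mulr_sumr; congr (_ * _).
rewrite exchange_big /=; apply: eq_bigr => x _.
by rewrite exchange_big /=.
Qed.

(* The qubits of [K] that are read in the Hadamard basis. *)
Definition hwire (i : 'I_N) : bool := (i \in K) && (i < n)%N.

Definition sgn (y w : bits N) : R :=
  \prod_(i < N) (if hwire i then (-1) ^+ (y i && w i) else 1).

(** The part of [w] seen by the computational-basis measurement; equality of these parts defines the
    set S. *)
Definition off (w : bits N) : bits N := [ffun i => w i && ~~ hwire i].

Definition mix (y w : bits N) : bits N :=
  [ffun i => if hwire i then y i else w i].

(** Averages over all N bits although signs involve only the measured Hadamard wires: the other bits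
    average out, and no strings indexed by a subset of the wires are needed. *)
Definition mean (g : bits N -> R) : R := 2^-1 ^+ N * \sum_(y : bits N) g y.

Lemma mean_prod (g : 'I_N -> bool -> R) :
  mean (fun y => \prod_(i < N) g i (y i)) =
  \prod_(i < N) (2^-1 * (g i false + g i true)).
Proof.
rewrite big_split /= prodr_const card_ord; congr (_ * _).
under [RHS]eq_bigr do rewrite addrC -big_bool.
by rewrite bigA_distr_bigA.
Qed.

(** Turns the outcome into a condition on each wire, so that sums over outcomes factor. *)
Lemma outcomeP (z : #|K|.-tuple bool) : exists zeta : bits N,
  forall y : bits N, (outcome K y == z) = [forall i, (i \in K) ==> (y i == zeta i)].
Proof.
exists [ffun i => nth false z (index i (enum K))] => y.
apply/eqP/forallP => [<- i|h].
  apply/implyP => iK; rewrite ffunE (nth_map i) ?index_mem ?mem_enum //.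
  by rewrite nth_index ?mem_enum.
apply: (@eq_from_nth _ false); first by rewrite size_map -cardE size_tuple.
move=> k; rewrite size_map => lk.
have i0 : 'I_N by case: (enum K) lk.
rewrite (nth_map i0) //; have := h (nth i0 (enum K) k).
rewrite -mem_enum mem_nth //= ffunE => /eqP ->.
by rewrite index_uniq // enum_uniq.
Qed.

Lemma off_eq (w w' : bits N) :
  (off w == off w') = [forall i, ~~ hwire i ==> (w i == w' i)].
Proof.
apply/eqP/forallP => [e i|h].
  have := congr1 (fun u : bits N => u i) e; rewrite !ffunE.
  by case: (hwire i); rewrite //= !andbT => ->.
apply/ffunP => i; rewrite !ffunE; have := h i.
by case: (hwire i); rewrite /= ?andbF // !andbT => /eqP.
Qed.

Lemma prod_nat_forall (p : pred 'I_N) :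
  \prod_(i < N) (p i)%:R = [forall i, p i]%:R :> R.
Proof.
case: (boolP [forall i, _]) => [/forallP h|]; first by rewrite big1 // => i _; rewrite h.
by move=> h; case/forallPn: h => i /negbTE e; rewrite (bigD1 i) //= e mul0r.
Qed.

(** Both sides factor over the wires. An unmeasured wire gives a Kronecker delta by orthogonality of
    H or I, a measured wire without Hadamard gate a delta and its observed bit, and a measured
    Hadamard wire half a product of signs. *)
Lemma sum_layers (z : #|K|.-tuple bool) (w w' : bits N) :
  \sum_(y : bits N | outcome K y == z) layer_re y w * layer_re y w' =
  (off w == off w')%:R *
  mean (fun y => sgn y w * sgn y w' * (outcome K (mix y w) == z)%:R).
Proof.
have [zeta ez] := outcomeP z.
pose g i (b : bool) : R := (if hwire i then (-1) ^+ (b && w i) else 1) *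
  (if hwire i then (-1) ^+ (b && w' i) else 1) *
  ((i \in K) ==> ((if hwire i then b else w i) == zeta i))%:R.
have -> : mean (fun y => sgn y w * sgn y w' * (outcome K (mix y w) == z)%:R) =
    mean (fun y => \prod_(i < N) g i (y i)).
  congr (_ * _); apply: eq_bigr => y _; rewrite ez -prod_nat_forall -!big_split /=.
  by apply: eq_bigr => i _; rewrite ffunE.
rewrite mean_prod off_eq -prod_nat_forall -big_split /=.
pose a i (b : bool) : R := ((i \in K) ==> (b == zeta i))%:R *
  ((if (i < n)%N then hadamard_re b (w i) else (b == w i)%:R) *
   (if (i < n)%N then hadamard_re b (w' i) else (b == w' i)%:R)).
transitivity (\sum_(y : bits N) \prod_(i < N) a i (y i)).
  rewrite big_mkcond; apply: eq_bigr => y _; rewrite ez.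
  rewrite /a !big_split /= prod_nat_forall.
  by case: ifP => _; rewrite ?mul1r // mul0r.
rewrite -bigA_distr_bigA; apply: eq_bigr => i _.
(* On one wire this is a finite check over membership in [K], presence of a Hadamard gate and three
   bits. *)
rewrite big_bool /a /g /hadamard_re /hwire.
have h := s2_sqr; rewrite expr2 in h.
case: (i \in K); case: ltnP => _ /=; case: (w i); case: (w' i); case: (zeta i);
  rewrite /= ?expr0 ?expr1; lra.
Qed.

(** Orthogonality of characters: a Hadamard wire on which the rows differ has mean 0. *)
Lemma mean_sgn (w w' : bits N) : off w = off w' ->
  mean (fun y => sgn y w * sgn y w') = (w == w')%:R.
Proof.
move=> e.
pose g i (b : bool) : R := (if hwire i then (-1) ^+ (b && w i) else 1) *
  (if hwire i then (-1) ^+ (b && w' i) else 1).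
have -> : mean (fun y => sgn y w * sgn y w') =
    mean (fun y => \prod_(i < N) g i (y i)).
  by congr (_ * _); apply: eq_bigr => y _; rewrite -big_split.
rewrite mean_prod.
have -> : (w == w') = [forall i, w i == w' i].
  by apply/eqP/forallP => [-> //|h]; apply/ffunP => i; apply/eqP.
rewrite -prod_nat_forall; apply: eq_bigr => i _; rewrite /g.
have := congr1 (fun u : bits N => u i) e; rewrite !ffunE.
by case: (hwire i); case: (w i); case: (w' i) => //= _; rewrite ?expr0 ?expr1; lra.
Qed.

End Amplitudes.

(** * Rows of bits as basis states *)

Definition row N (w : bits N) : seq bool := [seq w i | i <- enum 'I_N].

Lemma size_row N (w : bits N) : size (row w) = N.
Proof. by rewrite size_map size_enum_ord. Qed.

Lemma row_inj N : injective (@row N).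
Proof.
move=> u v /eq_in_map e; apply/ffunP => i.
by apply: e; rewrite mem_enum.
Qed.

Lemma row_surj N u : size u = N -> exists w : bits N, row w = u.
Proof.
move=> zu; exists [ffun i : 'I_N => nth false u i].
apply: (@eq_from_nth _ false); rewrite size_row // => i lt.
by rewrite (nth_map (Ordinal lt)) ?size_enum_ord // ffunE nth_enum_ord.
Qed.

Definition gate_row N (g : gate N) : row_gate :=
  (mask_of [set target g], mask_of (controls g)).

Lemma zip_maps (T : Type) (a b : T -> bool) s :
  zip [seq a i | i <- s] [seq b i | i <- s] = [seq (a i, b i) | i <- s].
Proof. by elim: s => //= x s ->. Qed.

Lemma all_enum N (p : pred 'I_N) : all p (enum 'I_N) = [forall i, p i].
Proof.
by apply/allP/forallP => [h i|h i _]; rewrite ?h ?mem_enum.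
Qed.

Lemma row_actE N (g : gate N) w : row_act (row w) (gate_row g) = row (gate_act g w).
Proof.
rewrite /row_act /flip /gate_row /= /mask_of /row zip_maps -map_comp.
apply: eq_map => i /=; rewrite ffunE inE; congr (_ (+) (_ && _)).
by rewrite /enabled zip_maps all_map all_enum.
Qed.

Lemma row_actsE N (C : circuit N) w :
  row_acts (map (@gate_row N) C) (row w) = row (circuit_act C w).
Proof. by elim: C w => //= g C IH w; rewrite row_actE IH. Qed.

Lemma size_mask_of N (A : {set 'I_N}) : size (mask_of A) = N.
Proof. by rewrite size_map size_enum_ord. Qed.

Lemma gates_well_sized N (C : circuit N) : well_sized N (map (@gate_row N) C).
Proof.
rewrite /well_sized; elim: C => //= g {}C ->; rewrite andbT.
rewrite !size_mask_of !eqxx !andbT.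
exact: leq_ltn_trans (leq0n _) (ltn_ord (target g)).
Qed.

Lemma gates_target_free N (C : circuit N) :
  all target_free_row (map (@gate_row N) C).
Proof.
elim: C => //= g {}C ->; rewrite andbT /target_free_row /= zip_maps has_map.
apply/hasPn => i _ /=; rewrite inE; apply/negP => /andP[/eqP -> ].
by apply/negP; exact: target_free.
Qed.

Lemma stream_gates N (C : circuit N) :
  stream (map (@gate_row N) C) = flatten [seq encode_gate g | g <- C].
Proof. by rewrite /stream -map_comp. Qed.

Lemma circuit_act_inj N (C : circuit N) : injective (circuit_act C).
Proof.
elim: C => [|g C IH] x y //= /IH.
exact: (can_inj (gate_actK g)).
Qed.

Lemma hadamard_rowE N m : (m <= N)%N ->
  hadamard_row N m = [seq (nat_of_ord i < N - m)%N | i <- enum 'I_N].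
Proof.
move=> le; apply: (@eq_from_nth _ false).
  by rewrite size_hadamard_row // size_map size_enum_ord.
rewrite size_hadamard_row // => i lt.
rewrite (nth_map (Ordinal lt)) ?size_enum_ord // nth_enum_ord //.
by rewrite nth_cat size_nseq !nth_nseq; case: ltnP => // ?; case: ifP.
Qed.

(** * The counts of the program as amplitudes of the circuit *)

Section Sampling.
Variables (R : realType) (N m : nat) (C : circuit N) (K : {set 'I_N}).
Hypothesis le_mN : (m <= N)%N.

Local Notation n := (N - m)%N.
Local Notation gs := (map (@gate_row N) C).
Local Notation h := (hadamard_row N m).
Local Notation hw := (hwire m K).

Definition rrow (w : bits N) : seq bool := rev (row w).

Lemma rrowE w : rrow w = [seq w i | i <- rev (enum 'I_N)].
Proof. by rewrite map_rev. Qed.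

Definition jrow : seq bool := rev (meet_row h (mask_of K)).
Local Notation j := jrow.
Local Notation k := (ones jrow).

Lemma jrowE : j = [seq hw i | i <- rev (enum 'I_N)].
Proof.
rewrite /jrow /meet_row hadamard_rowE // /mask_of zip_maps -map_comp map_rev.
by congr rev; apply: eq_map => i /=; rewrite /hwire andbC.
Qed.

Lemma size_jrow : size j = N.
Proof. by rewrite jrowE size_map size_rev size_enum_ord. Qed.

Lemma ones_jrow_le : (k <= #|K|)%N.
Proof.
rewrite jrowE /ones count_map count_rev -size_filter cardE.
rewrite [X in (_ <= size X)%N](_ : _ = [seq i <- enum 'I_N | i \in K]).
  by rewrite !size_filter; apply: sub_count => i /andP[].
by rewrite enumT.
Qed.

Lemma mask0_rrow w : mask0 j (rrow w) = rrow (off m K w).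
Proof.
rewrite jrowE !rrowE /mask0 zip_maps -map_comp; apply: eq_map => i /=.
by rewrite ffunE.
Qed.

Lemma meet_rrow (y : bits N) :
  meet_row j (rrow y) = [seq hw i && y i | i <- rev (enum 'I_N)].
Proof. by rewrite jrowE !rrowE /meet_row zip_maps -map_comp. Qed.

Lemma sgn_parity (y w : bits N) :
  (-1) ^+ parity (meet_row j (rrow y)) (rrow w) = sgn R m K y w.
Proof.
rewrite meet_rrow rrowE /sgn -big_enum /=.
rewrite -[RHS](perm_big _ (permEl (perm_rev (enum 'I_N)))) /=.
rewrite /parity zip_maps; elim: (rev _) => [|i l IH] /=; first by rewrite big_nil.
rewrite big_cons -IH signr_addb; congr (_ * _).
by case: (hw i); rewrite /= ?expr0.
Qed.

Lemma valid_rrow x :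
  valid (rev_gates gs) h (rrow (circuit_act C x)) = start m x.
Proof.
have ws := gates_well_sized C; have fr := gates_target_free C.
rewrite /valid /rrow -row_actsE (row_acts_rev ws fr (size_row _)) revK.
rewrite /allowed hadamard_rowE // zip_maps all_map all_enum.
by apply: eq_forallb => i /=; case: (x i) => /=; case: ltnP.
Qed.

(** Used with [phi] the circuit, to index rows by their preimages. *)
Lemma big_rrow (V : nmodType) (F : seq bool -> V) (phi : bits N -> bits N) :
  injective phi -> \sum_(x : bits N) F (rrow (phi x)) = \sum_(u <- rows N) F u.
Proof.
move=> inj; apply: (@big_rows_fin _ _ _ (fun x => rrow (phi x))).
- by move=> x y /(can_inj revK)/row_inj/inj.
- by move=> x; rewrite size_rev size_row.
move=> u zu; have [w ew] := @row_surj N (rev u) (etrans (size_rev u) zu).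
have [psi _ psiK] := injF_bij inj.
by exists (psi w); rewrite /rrow psiK ew revK.
Qed.

Definition basis_row (w : bits N) : seq bool := mask0 j (rrow w).

Definition key (x : bits N) : bits N := off m K (circuit_act C x).

Definition amplitude (y : bits N) : bits N -> R :=
  class_sum key (start m) (fun x => sgn R m K y (circuit_act C x)).

Definition multiplicity : bits N -> R := class_sum key (start m) (fun=> 1).

(** The enumerated rows are written as C(x'). Agreement off the counted wires then becomes equality
    of keys, and validity says that x' is a possible input. *)
Lemma net_amplitude x y :
  (net_signs gs h j (basis_row (circuit_act C x)) (meet_row j (rrow y)))%:R ^+ 2
  = amplitude y x ^+ 2.
Proof.
rewrite /net_signs net_sqr /basis_row; congr (_ ^+ 2).
set z := meet_row j (rrow y).
pose F u : R := if valid (rev_gates gs) h u then (-1) ^+ parity z u else 0.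
rewrite -[LHS]/(\sum_(i < 2 ^ k) F (iter i (inc true j)
  (mask0 j (rrow (circuit_act C x))))).
rewrite big_inc; last by rewrite size_jrow size_rev size_row.
rewrite size_jrow -(big_rrow _ (@circuit_act_inj _ C)) /amplitude /class_sum.
rewrite [RHS]big_mkcond; apply: eq_bigr => x' _.
rewrite /F valid_rrow !mask0_rrow (can_eq revK) (inj_eq (@row_inj N)).
rewrite /key sgn_parity andbC.
by case: (_ == _).
Qed.

(** Each candidate on the k Hadamard wires of [K] comes from 2^(N - k) rows [y]. *)
Lemma weight_mean x (G : seq bool -> R) :
  weight (net_signs gs h j (basis_row (circuit_act C x))) j G =
  2 ^+ k * mean (fun y => amplitude y x ^+ 2 * G (meet_row j (rrow y))).
Proof.
set f := net_signs _ _ _ _; have lk : (k <= N)%N by rewrite -size_jrow count_size.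
have e := big_meet j (fun z => (f z)%:R ^+ 2 * G z).
rewrite -/(weight f j G) size_jrow in e.
have e2 : \sum_(y : bits N) amplitude y x ^+ 2 * G (meet_row j (rrow y)) =
    weight f j G * 2 ^+ (N - k).
  rewrite -natrX mulr_natr -e.
  rewrite -(@big_rrow _ (fun u => (f (meet_row j u))%:R ^+ 2 * G (meet_row j u)) id) //.
  by apply: eq_bigr => y _; rewrite net_amplitude.
have eN : 2 ^+ N = 2 ^+ (N - k) * 2 ^+ k :> R by rewrite -exprD subnK.
rewrite /mean e2 exprVn eN.
have p2 i : 2 ^+ i != 0 :> R by rewrite expf_neq0 // pnatr_eq0.
by field; rewrite !p2.
Qed.

(** Parseval: cross terms vanish by [mean_sgn] and injectivity of the circuit, and each diagonal
    term is 1. *)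
Lemma mean_sqr_amplitude x : mean (fun y => amplitude y x ^+ 2) = multiplicity x.
Proof.
have -> : mean (fun y => amplitude y x ^+ 2) =
  \sum_(x1 | start m x1 && (key x1 == key x))
    \sum_(x2 | start m x2 && (key x2 == key x))
      mean (fun y => sgn R m K y (circuit_act C x1) * sgn R m K y (circuit_act C x2)).
  rewrite /mean; under [RHS]eq_bigr do rewrite -mulr_sumr exchange_big /=.
  rewrite -mulr_sumr exchange_big /=; congr (_ * _); apply: eq_bigr => y _.
  by rewrite expr2 mulr_suml; apply: eq_bigr => x1 _; rewrite mulr_sumr.
apply: eq_bigr => x1 /andP[s1 /eqP k1].
rewrite (bigD1 x1) /=; last by rewrite s1 k1 eqxx.
rewrite mean_sgn // eqxx big1 ?addr0 // => x2 /andP[/andP[_ /eqP k2] ne].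
rewrite mean_sgn; last by rewrite -/(key x1) k1 -k2.
by rewrite (inj_eq (@circuit_act_inj _ C)) eq_sym (negbTE ne).
Qed.

Definition sampled (w y : bits N) : bits N := mix m K y w.

(** The exact law as a classical experiment: a uniform input x, then z drawn by squared amplitude
    over the size of the class of x. It follows from [sum_layers] and [class_average]. *)
Lemma hcmq_prob_class (z : #|K|.-tuple bool) :
  hcmq_prob R m C z = 2^-1 ^+ n * \sum_(x | start m x)
    mean (fun y => amplitude y x ^+ 2 *
      (outcome K (sampled (circuit_act C x) y) == z)%:R) / multiplicity x.
Proof.
rewrite hcmq_probE //; congr (_ * _).
pose G y x : R := (outcome K (sampled (circuit_act C x) y) == z)%:R.
transitivity (mean (fun y => \sum_(x | start m x)
    G y x * sgn R m K y (circuit_act C x) * amplitude y x)).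
  rewrite /mean [in RHS]exchange_big [in RHS]mulr_sumr /=; apply: eq_bigr => x _.
  rewrite /amplitude /class_sum.
  under [in RHS]eq_bigr do rewrite mulr_sumr.
  rewrite [in RHS]exchange_big [in RHS]big_mkcondr [in RHS]mulr_sumr /=.
  apply: eq_bigr => x' _.
  rewrite sum_layers // /mean eq_sym.
  case: eqP => _; last by rewrite mul0r mulr0.
  rewrite mul1r; congr (_ * _); apply: eq_bigr => y _; rewrite /G; ring.
transitivity (mean (fun y => \sum_(x | start m x)
    G y x * amplitude y x ^+ 2 / multiplicity x)).
  congr (_ * _); apply: eq_bigr => y _; rewrite /amplitude class_average //.
  (* [mix] overwrites exactly the wires that [off] forgets, so [G] depends on x through its key
     only. *)
  move=> x x' e; rewrite /G; congr ((outcome K _ == _)%:R).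
  apply/ffunP => i; rewrite !ffunE.
  have := congr1 (fun u : bits N => u i) e; rewrite !ffunE.
  by case: (hw i); rewrite //= !andbT.
rewrite /mean [in LHS]exchange_big [in LHS]mulr_sumr /=; apply: eq_bigr => x _.
rewrite -mulrA mulr_suml; congr (_ * _).
by apply: eq_bigr => y _; rewrite /G; ring.
Qed.

Lemma outcome_mask w : outcome K w = mask (mask_of K) (row w).
Proof.
rewrite /outcome /row /mask_of -map_mask -filter_mask; congr map.
by rewrite enumT.
Qed.

Definition read_row (v s : seq bool) : seq bool :=
  rev (mask (rev (mask_of K)) (merge_row v s)).

Lemma merge_rowE (T : Type) (a b : T -> bool) l :
  merge_row [seq a i | i <- l] [seq b i | i <- l] = [seq a i || b i | i <- l].
Proof. by elim: l => //= x l ->. Qed.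

Lemma rev_mask_rrow w : rev (mask (rev (mask_of K)) (rrow w)) = outcome K w.
Proof.
by rewrite -rev_mask ?revK -?outcome_mask // size_row size_mask_of.
Qed.

Lemma read_basis w y :
  read_row (basis_row w) (meet_row j (rrow y)) = outcome K (sampled w y).
Proof.
rewrite -rev_mask_rrow /read_row /basis_row mask0_rrow meet_rrow !rrowE merge_rowE.
congr (rev (mask _ _)); apply: eq_map => i; rewrite !ffunE.
by case: (hw i); case: (y i); case: (w i).
Qed.

Lemma size_read_row v s : size v = N -> (size s <= N)%N ->
  size (read_row v s) = #|K|.
Proof.
move=> zv zs; rewrite size_rev size_mask.
  rewrite count_rev /mask_of count_map cardE.
  rewrite (_ : enum K = [seq i <- enum 'I_N | i \in K]) ?size_filter //.
  by rewrite enumT.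
rewrite size_rev size_mask_of -zv; elim: v s {zv zs} => [|y v IH] [|x s] //=.
by rewrite -(IH s).
Qed.

End Sampling.

(** * The sampling error *)

Lemma run_exec P x rs st' rs' c T :
  exec P (upd (fun=> [::]) 0 x) rs st' rs' c -> (c <= T)%N ->
  run P x rs T = Config [::] st' rs'.
Proof.
move=> /(_ [::])[n' le e] lT; rewrite /run /init.
rewrite -(subnK (leq_trans le lT)) iterD e.
by elim: (T - n')%N => //= i ->.
Qed.

(** Splits the uniform tape into input coins, trial coins and a remainder that does not influence
    the output. *)
Lemma out_probE (R : realType) P x n1 n2 n3 z (f : seq bool -> seq bool -> seq bool) :
  (forall xs cs rs, size xs = n1 -> size cs = n2 -> size rs = n3 ->
     output (run P x (xs ++ cs ++ rs) (n1 + (n2 + n3))) = f xs cs) ->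
  out_prob R P x (n1 + (n2 + n3)) z =
  2^-1 ^+ n1 * \sum_(xs <- rows n1)
    (2^-1 ^+ n2 * \sum_(cs <- rows n2) (f xs cs == z)%:R).
Proof.
move=> H; rewrite /out_prob; set T := (n1 + _)%N.
have -> : #|[set rs : T.-tuple bool | output (run P x rs T) == z]|%:R =
   \sum_(u <- rows T) (output (run P x u T) == z)%:R :> R.
  rewrite -(@big_rows_tuple _ T (fun u => (output (run P x u T) == z)%:R)).
  rewrite -sum1_card natr_sum big_mkcond; apply: eq_bigr => u _.
  by rewrite inE; case: ifP.
rewrite {1}/T big_rowsD -mulr_sumr mulrA -exprVn.
have -> : 2^-1 ^+ T = 2^-1 ^+ n1 * 2^-1 ^+ n2 * 2^-1 ^+ n3 :> R.
  by rewrite /T !exprD mulrA.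
rewrite mulrC -!mulrA; congr (_ * (_ * _)); rewrite mulr_sumr.
rewrite big_seq [RHS]big_seq; apply: eq_bigr => xs; rewrite mem_rows => /eqP zx.
rewrite big_rowsD mulr_sumr big_seq [RHS]big_seq; apply: eq_bigr => cs.
rewrite mem_rows => /eqP zc.
transitivity (2^-1 ^+ n3 * \sum_(u <- rows n3) (f xs cs == z)%:R : R).
  congr (_ * _); rewrite big_seq [RHS]big_seq; apply: eq_bigr => rs.
  by rewrite mem_rows => /eqP zr; rewrite H.
rewrite big_rows_const -[_ *+ (2 ^ n3)%N]mulr_natr natrX exprVn mulrCA mulVf ?mulr1 //.
by rewrite expf_neq0 // pnatr_eq0.
Qed.

(** Each induction step loses exactly (L + 1) a^2. It bounds (1 - a)^L by a rational function,
    without exponentials. *)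
Lemma bernoulli (R : realFieldType) (a : R) L : 0 <= a <= 1 ->
  (1 - a) ^+ L * (1 + L%:R * a) <= 1.
Proof.
move=> /andP[a0 a1]; elim: L => [|L IH].
  by rewrite expr0 mul0r addr0 mul1r.
apply: le_trans IH; rewrite exprSr -mulrA ler_wpM2l ?exprn_ge0 ?subr_ge0 //.
rewrite -[in leLHS]natr1; have : 0 <= L%:R :> R by rewrite ler0n.
move: (L%:R) => l l0; have : 0 <= l * (a * a) by rewrite !mulr_ge0.
have : 0 <= a * a by rewrite mulr_ge0.
move=> aa laa; rewrite -subr_ge0 (_ : _ - _ = l * (a * a) + a * a); last by ring.
by rewrite addr_ge0.
Qed.

Section Error.
Variables (R : realType) (N m : nat) (C : circuit N) (K : {set 'I_N}).
Hypothesis le_mN : (m <= N)%N.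

Local Notation n := (N - m)%N.
Local Notation gs := (map (@gate_row N) C).
Local Notation h := (hadamard_row N m).
Local Notation j := (jrow m K).
Local Notation k := (ones (jrow m K)).

Lemma big_start (V : nmodType) (F : seq bool -> V) :
  \sum_(xs <- rows n) F (fill h xs) = \sum_(x : bits N | start m x) F (row x).
Proof.
rewrite -{1}(@ones_hadamard_row N m) big_fill size_hadamard_row // [RHS]big_mkcond.
rewrite -(@big_rows_fin _ _ _ (@row N) (fun u => if allowed h u then F u else 0)).
- apply: eq_bigr => x _; congr (if _ then _ else _).
  rewrite /allowed hadamard_rowE // zip_maps all_map all_enum.
  by apply: eq_forallb => i /=; case: (x i) => /=; case: ltnP.
- exact: row_inj.
- exact: size_row.
- exact: row_surj.
Qed.

Lemma card_start : \sum_(x : bits N | start m x) (1 : R) = 2 ^+ n.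
Proof. by rewrite -(big_start (fun=> 1)) big_rows_const natrX. Qed.

Definition conditional (x : bits N) (z : seq bool) : R :=
  mean (fun y => amplitude R m C K y x ^+ 2 *
    (outcome K (sampled m K (circuit_act C x) y) == z)%:R) / multiplicity R m C K x.

Definition failure (L : nat) (x : bits N) : R :=
  (1 - multiplicity R m C K x / 4 ^+ k) ^+ L.

Lemma mult_gt0 x : start m x -> 0 < multiplicity R m C K x.
Proof. exact: class_size_gt0. Qed.

Lemma weight1 x :
  weight (net_signs gs h j (basis_row m K (circuit_act C x))) j (fun=> 1) =
  2 ^+ k * multiplicity R m C K x.
Proof.
rewrite weight_mean // -(mean_sqr_amplitude R m C K x).
by congr (_ * (_ * _)); apply: eq_bigr => y _; rewrite mulr1.
Qed.

(** Each count is at most 2^k, so the total weight is at most 8^k; hence the success rate of a trial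
    is at most 1. *)
Lemma mult_le x : multiplicity R m C K x <= 4 ^+ k.
Proof.
have p2 : 0 < 2 ^+ k :> R by rewrite exprn_gt0 // ltr0n.
rewrite -(ler_pM2l p2) -weight1 /weight.
rewrite (_ : _ * _ = \sum_(c <- rows k) (4 ^+ k : R)); last first.
  by rewrite big_rows_const -[_ *+ (2 ^ k)%N]mulr_natl natrX.
apply: ler_sum => c _; rewrite mulr1 (_ : 4 = 2 ^+ 2); last by rewrite -natrX.
rewrite -exprM mulnC exprM lerXn2r ?nnegrE ?ler0n ?exprn_ge0 //.
by rewrite -natrX ler_nat; exact: net_le.
Qed.

Lemma sum_trials_conditional L x z : start m x ->
  let v := basis_row m K (circuit_act C x) in
  2^-1 ^+ (L * (3 * k)) * \sum_(cs <- rows (L * (3 * k)))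
    (read_row K v (trials (net_signs gs h j v) j L cs) == z)%:R =
  (1 - failure L x) * conditional x z + failure L x * (read_row K v [::] == z)%:R.
Proof.
move=> sx v; have p2 i : 2 ^+ i != 0 :> R by rewrite expf_neq0 // pnatr_eq0.
have m0 := lt0r_neq0 (mult_gt0 sx).
have le z' : (net_signs gs h j v z' <= 2 ^ k)%N by exact: net_le.
rewrite (sum_trials le L (fun s => (read_row K v s == z)%:R)); last first.
  by rewrite weight1 mulf_neq0.
rewrite mulrA -exprMn mulVf ?pnatr_eq0 // expr1n mul1r /= weight1 weight_mean //.
have -> : 1 - 2 ^+ k * multiplicity R m C K x / 2 ^+ (3 * k) =
    1 - multiplicity R m C K x / 4 ^+ k.
  rewrite (_ : 4 = 2 ^+ 2); last by rewrite -natrX.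
  rewrite -exprM (_ : 3 * k = k + 2 * k)%N; last by lia.
  by rewrite exprD; field; rewrite !p2.
rewrite -/(failure L x); congr (_ * _ + _).
rewrite /conditional -mulf_div divff // mul1r; congr (_ / _); congr (_ * _).
by apply: eq_bigr => y _; rewrite read_basis.
Qed.

Lemma sum_outcome (w : bits N) :
  \sum_(z : #|K|.-tuple bool) (outcome K w == z)%:R = 1 :> R.
Proof.
have zw : size (outcome K w) == #|K| by rewrite size_map -cardE.
rewrite (bigD1 (Tuple zw)) //= eqxx big1 ?addr0 // => z ne.
by case: eqP => // e; case/negP: ne; apply/eqP/val_inj.
Qed.

Lemma conditional_ge0 x z : start m x -> 0 <= conditional x z.
Proof.
move=> sx; apply: divr_ge0; last by rewrite ltW ?mult_gt0.
rewrite /mean mulr_ge0 ?exprn_ge0 ?invr_ge0 //; apply: sumr_ge0 => y _.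
by rewrite mulr_ge0 ?sqr_ge0.
Qed.

Lemma sum_conditional x : start m x ->
  \sum_(z : #|K|.-tuple bool) conditional x z = 1.
Proof.
move=> sx; rewrite -mulr_suml -mulr_sumr exchange_big /=.
under eq_bigr do rewrite -mulr_sumr sum_outcome mulr1.
have := mean_sqr_amplitude R m C K x; rewrite /mean => ->.
by rewrite divff // lt0r_neq0 // mult_gt0.
Qed.

Lemma failure_bound b x : start m x ->
  failure (b * 4 ^ k) x <= (1 + b%:R)^-1.
Proof.
move=> sx; set a := multiplicity R m C K x / 4 ^+ k.
have p4 : 0 < 4 ^+ k :> R by rewrite exprn_gt0 // ltr0n.
(* [x] belongs to its own class. *)
have m1 : 1 <= multiplicity R m C K x.
  by rewrite /multiplicity /class_sum (bigD1 x) ?sx ?eqxx //= lerDl sumr_ge0.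
have a1 : 0 <= a <= 1.
  apply/andP; split; last by rewrite /a ler_pdivrMr // mul1r mult_le.
  by rewrite mulr_ge0 ?invr_ge0 // ltW // mult_gt0.
rewrite -[leRHS]mul1r ler_pdivlMr; last by rewrite ltr_pwDl ?ler0n.
apply: le_trans (bernoulli (b * 4 ^ k) a1); rewrite ler_wpM2l //.
  by rewrite exprn_ge0 // subr_ge0; case/andP: a1.
have -> : (b * 4 ^ k)%:R * a = b%:R * multiplicity R m C K x.
  by rewrite natrM natrX /a; field; rewrite lt0r_neq0.
rewrite lerD2l.
by rewrite ler_peMr ?ler0n.
Qed.

(** For each input the two laws differ by the failure probability times the difference of two
    distributions, the conditional law and a point mass; hence the factor 2. *)
Lemma sampling_error P x T b :
  let L := (b * 4 ^ k)%N in
  (n + L * (3 * k) <= T)%N ->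
  (forall xs cs rs, size xs = n -> size cs = (L * (3 * k))%N ->
     output (run P x (xs ++ cs ++ rs) T) = result N m gs (mask_of K) L xs cs) ->
  \sum_(z : #|K|.-tuple bool) `|hcmq_prob R m C z - out_prob R P x T z| <=
  2 / (1 + b%:R).
Proof.
move=> L lT H.
have zv w : size (basis_row m K w) = N.
  by rewrite size_mask0 ?size_jrow // /rrow size_rev size_row.
have q z : out_prob R P x T z = 2^-1 ^+ n * \sum_(x | start m x)
    ((1 - failure L x) * conditional x z +
     failure L x * (read_row K (basis_row m K (circuit_act C x)) [::] == z)%:R).
  have eT : T = (n + (L * (3 * k) + (T - (n + L * (3 * k)))))%N by lia.
  move: H; rewrite eT => H.
  rewrite (@out_probE R P x n (L * (3 * k)) _ z (result N m gs (mask_of K) L)); last first.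
    by move=> xs cs rs zx zc _; apply: H.
  congr (_ * _).
  rewrite (big_start (fun u => let v := mask0 j (rev (row_acts gs u)) in
    2^-1 ^+ (L * (3 * k)) * \sum_(cs <- rows (L * (3 * k)))
    (read_row K v (trials (net_signs gs h j v) j L cs) == z)%:R)).
  apply: eq_bigr => u su; rewrite row_actsE -(sum_trials_conditional L z su).
  by [].
have p (z : #|K|.-tuple bool) : hcmq_prob R m C z = 2^-1 ^+ n * \sum_(x | start m x) conditional x z.
  by rewrite hcmq_prob_class.
have f0 u : 0 <= failure L u.
  rewrite exprn_ge0 // subr_ge0 ler_pdivrMr ?mul1r ?mult_le //.
  by rewrite exprn_gt0 // ltr0n.
have pn : 0 <= 2^-1 ^+ n :> R by rewrite exprn_ge0 // invr_ge0.
apply: (@le_trans _ _ (\sum_(z : #|K|.-tuple bool) 2^-1 ^+ n *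
   \sum_(x | start m x) failure L x * (conditional x z +
     (read_row K (basis_row m K (circuit_act C x)) [::] == z)%:R))).
  apply: ler_sum => z _; rewrite p q -mulrBr normrM ger0_norm //.
  rewrite ler_wpM2l // -sumrB; apply: le_trans (ler_norm_sum _ _ _) _.
  apply: ler_sum => u su.
  set a := conditional u z; set t := _%:R.
  rewrite (_ : _ - _ = failure L u * (a - t)); last by ring.
  rewrite normrM ger0_norm // ler_wpM2l //.
  apply: le_trans (ler_normB _ _) _.
  by rewrite !ger0_norm ?ler0n // conditional_ge0.
rewrite -mulr_sumr exchange_big /=.
apply: (@le_trans _ _ (2^-1 ^+ n * \sum_(x : bits N | start m x) (2 / (1 + b%:R)))).
  rewrite ler_wpM2l //; apply: ler_sum => u su.
  rewrite -mulr_sumr big_split /= sum_conditional //.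
  rewrite [2 / _]mulrC; apply: ler_pM => //.
  - apply: addr_ge0 => //; exact: sumr_ge0.
  - exact: failure_bound.
  rewrite (_ : 2 = 1 + 1) // lerD2l.
  set v := read_row _ _ _; have zw : size v == #|K|.
    by rewrite size_read_row.
  rewrite (bigD1 (Tuple zw)) //= eqxx big1 ?addr0 // => z ne.
  by case: eqP => // e; case/negP: ne; apply/eqP/val_inj.
rewrite -[X in \sum_(_ | _) X]mul1r -mulr_suml card_start mulrA -exprMn.
by rewrite mulVf ?pnatr_eq0 // expr1n mul1r.
Qed.

End Error.

(** * Polynomial bounds *)

(** Bounds the polynomial by the sum of the absolute values of its coefficients times a power of N +
    1, a base that is at least 1 even when N = 0. *)
Lemma poly_le_monomial (R : realType) (r : {poly R}) :
  exists b, exists d, forall N : nat, r.[N%:R] <= (b * N.+1 ^ d)%:R.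
Proof.
pose s := \sum_(i < size r) `|r`_i|.
have s0 : 0 <= s by apply: sumr_ge0.
exists (Num.bound s), (size r) => N.
rewrite natrM natrX; have N1 : 1 <= N.+1%:R :> R by rewrite ler1n.
apply: (@le_trans _ _ (s * N.+1%:R ^+ size r)); last first.
  by rewrite ler_wpM2r ?exprn_ge0 // ltW // archi_boundP.
rewrite horner_coef /s mulr_suml; apply: ler_sum => i _.
apply: le_trans (ler_norm _) _; rewrite normrM ler_wpM2l // normrX normr_nat.
apply: (@le_trans _ _ (N.+1%:R ^+ i)).
  by rewrite lerXn2r ?nnegrE ?ler0n // ler_nat.
by rewrite ler_weXn2l // ltnW.
Qed.

(** 2^k <= e^k <= (N + 1)^a with a an integer above [c]; the first inequality is 1 + x <= e^x at x =
    1. *)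
Lemma exp_log_bound (R : realType) (c : R) : 0 < c ->
  exists a, forall N k : nat, k%:R <= c * ln (N%:R : R) -> (2 ^ k <= N.+1 ^ a)%N.
Proof.
move=> c0; exists (Num.bound c) => N k le.
have le' : k%:R <= ln (N.+1%:R ^+ Num.bound c : R).
  rewrite lnXn ?ltr0n //; apply: le_trans le _.
  have lN0 : 0 <= ln (N.+1%:R : R) by rewrite ln_ge0 // ler1n.
  have lN : ln (N%:R : R) <= ln (N.+1%:R : R).
    (* For N = 0 the logarithm takes its default value 0. *)
    case: (N) => [|M]; first by rewrite ln0 // ln1.
    by rewrite ler_ln ?posrE ?ltr0n // ler_nat.
  rewrite -[leRHS]mulr_natl; apply: (@le_trans _ _ (c * ln (N.+1%:R : R))).
    apply: ler_wpM2l => //; exact: ltW.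
  apply: ler_wpM2r => //; apply: ltW; apply: archi_boundP; exact: ltW.
rewrite -(ler_nat R) !natrX.
apply: (@le_trans _ _ (sequences.expR (k%:R : R))).
  rewrite -[X in sequences.expR X]mulr1 expRM_natl.
  by rewrite lerXn2r ?nnegrE ?expR_ge0 //; exact: (expR_ge1Dx (1 : R)).
by rewrite -[leRHS]lnK ?ler_expR // posrE exprn_gt0.
Qed.

Definition poly_function (f : nat -> nat) := exists t : {poly nat}, forall N, t.[N] = f N.

Lemma poly_function_const a : poly_function (fun=> a).
Proof. by exists a%:P => N; rewrite hornerC. Qed.

Lemma poly_function_id : poly_function id.
Proof. by exists 'X => N; rewrite hornerX. Qed.

Lemma poly_function_add f g : poly_function f -> poly_function g ->
  poly_function (fun N => f N + g N)%N.
Proof. by move=> [t et] [u eu]; exists (t + u) => N; rewrite hornerD et eu. Qed.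

Lemma poly_function_mul f g : poly_function f -> poly_function g ->
  poly_function (fun N => f N * g N)%N.
Proof. by move=> [t et] [u eu]; exists (t * u) => N; rewrite hornerM et eu. Qed.

Lemma poly_function_exp f a : poly_function f -> poly_function (fun N => f N ^ a)%N.
Proof.
move=> pf; elim: a => [|a IH].
  by have [t et] := poly_function_const 1; exists t.
have [t et] := poly_function_mul pf IH.
by exists t => N; rewrite et expnS.
Qed.

(** [q] bounds 2^k, [q * q] bounds 4^k and N bounds k, which leaves a function of N alone. The last
    summand bounds the coins read, so that a tape of this length contains all the blocks. *)
Definition time_bound (a b d : nat) (s : nat -> nat) (N : nat) : nat :=
  let q := (N.+1 ^ a)%N in
  let L := (b * N.+1 ^ d * (q * q))%N in
  (main_cost b d N (s N) q L + (N + L * (3 * N)))%N.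

Lemma poly_function_time_bound a b d s :
  poly_function s -> poly_function (time_bound a b d s).
Proof.
move=> ps; have pN := poly_function_id.
have pS : poly_function (fun N => N.+1).
  by have [t et] := poly_function_add (poly_function_const 1) pN; exists t.
rewrite /time_bound /main_cost /trial_cost /visit_cost /half_cost.
by do ![exact: ps | exact: pN | exact: pS | exact: poly_function_const
  | apply: poly_function_add | apply: poly_function_mul | apply: poly_function_exp].
Qed.

Lemma main_cost_le b d N G G' q q' L L' :
  (G <= G' -> q <= q' -> L <= L' ->
  main_cost b d N G q L <= main_cost b d N G' q' L')%N.
Proof.
move=> lG lq lL.
have lh : (half_cost N G <= half_cost N G')%N.
  by rewrite /half_cost !leq_add ?leq_mul.
have lv : (visit_cost N G <= visit_cost N G')%N.
  by rewrite /visit_cost !leq_add ?leq_mul.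
have lt : (trial_cost N G q <= trial_cost N G' q')%N.
  by rewrite /trial_cost !(leq_add, leq_mul).
by rewrite /main_cost !(leq_add, leq_mul).
Qed.

Theorem theorem8 (R : realType) (c : R) (hc : 0 < c) (r : {poly R}) :
  exists P : prog,
  forall s : {poly nat}, exists t : {poly nat},
  forall (N m : nat) (C : circuit N) (K : {set 'I_N}),
    (m <= N)%N ->
    (size C <= s.[N])%N ->
    #|K|%:R <= c * ln (N%:R : R) ->
    let T := t.[N] in
    let x := encode m C K in
    (forall rs : T.-tuple bool,
       halted (run P x rs T) /\ size (output (run P x rs T)) = #|K|) /\
    (0 < r.[N%:R] ->
     \sum_(z : #|K|.-tuple bool)
        `| hcmq_prob R m C z - out_prob R P x T z | <= 1 / r.[N%:R]).
Proof.
(* The factor 2 matches the error 2 / (1 + B), where B is the monomial that bounds 2 r(N). *)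
have [b [d rb]] := poly_le_monomial (2%:P * r).
have [a ca] := exp_log_bound hc.
(* The program is built from [r]; the constant [c] and the gate bound [s] enter through the running
   time. *)
exists (main_prog b d) => s.
have [t et] : poly_function (time_bound a b d (fun N => s.[N])).
  by apply: poly_function_time_bound; exists s.
exists t => N m C K lm lC lK T x.
pose j := jrow m K; pose k := ones j.
pose B := (b * N.+1 ^ d)%N; pose L := (B * 4 ^ k)%N.
have lk : (2 ^ k <= N.+1 ^ a)%N.
  by apply: leq_trans (ca _ _ lK); rewrite leq_exp2l // ones_jrow_le.
have lkN : (k <= N)%N by rewrite -(size_jrow K lm) count_size.
have lL : (L <= B * (N.+1 ^ a * N.+1 ^ a))%N.
  by rewrite leq_mul2l (_ : 4 = 2 * 2)%N // expnMn leq_mul ?orbT.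
have lcost : (main_cost b d N (size C) (2 ^ k) L +
    (N - m + L * (3 * k)) <= T)%N.
  rewrite /T et /time_bound -/B leq_add ?main_cost_le //.
  by rewrite leq_add ?leq_subr // leq_mul // leq_mul2l lkN orbT.
have H xs cs rs : size xs = (N - m)%N -> size cs = (L * (3 * k))%N ->
    exists2 st, run (main_prog b d) x (xs ++ cs ++ rs) T = Config [::] st rs &
      output (Config [::] st rs) =
      result N m (map (@gate_row N) C) (mask_of K) L xs cs.
  move=> zx zc.
  have cyc w : size w = N ->
      iter (2 ^ k) (inc true j) (mask0 j w) = mask0 j w.
    by move=> zw; rewrite iter_inc_cycle // size_jrow.
  have [st eO e] := @exec_main b d N m (map (@gate_row N) C) (mask_of K) xs cs rs
    lm (size_mask_of K) (gates_well_sized C) (gates_target_free C) cyc zx zc.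
  rewrite stream_gates size_map in e; exists st => //.
  by apply: run_exec e _; apply: leq_trans lcost; exact: leq_addr.
split=> [rs|r0].
  pose xs := take (N - m) rs; pose cs := take (L * (3 * k)) (drop (N - m) rs).
  have zrs : size rs = T by rewrite size_tuple.
  have lT : (N - m + L * (3 * k) <= T)%N by apply: leq_trans lcost; exact: leq_addl.
  have zx : size xs = (N - m)%N by rewrite size_take_min zrs; lia.
  have zc : size cs = (L * (3 * k))%N by rewrite size_take_min size_drop zrs; lia.
  have -> : tval rs = xs ++ cs ++ drop (L * (3 * k)) (drop (N - m) rs).
    by rewrite !cat_take_drop.
  have [st -> ->] := H xs cs (drop (L * (3 * k)) (drop (N - m) rs)) zx zc.
  split=> //; apply: size_read_row; last first.
    by rewrite (leq_trans (size_trials _ _ _ _)) // size_jrow.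
  have zw : size (rev (row_acts (map (@gate_row N) C) (fill (hadamard_row N m) xs))) = N.
    rewrite size_rev (size_row_acts (gates_well_sized C)) //.
    by rewrite size_fill size_hadamard_row.
  by rewrite size_mask0 zw // size_jrow.
apply: (@le_trans _ _ (2 / (1 + B%:R))).
  apply: sampling_error => //; first by apply: leq_trans lcost; exact: leq_addl.
  by move=> xs cs rs zx zc; have [st -> ->] := H xs cs rs zx zc.
have := rb N; rewrite hornerM hornerC -/B => rB.
rewrite ler_pdivrMr; last by rewrite ltr_pwDl ?ler0n.
rewrite mulrAC mul1r ler_pdivlMr //; lra.
Qed.
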